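(* Let $n\ge 2$ be an integer, let $\{a_i : i\in[K]\}\subseteq \mathbb{S}^{D-1}$ and $\mathcal{A}=\operatorname{Span}\{a_i^{\otimes n}: i\in[K]\}$. Let $\hat{\mathcal{A}}\subseteq \operatorname{Sym}((\mathbb{R}^D)^{\otimes n})$ be a linear subspace (a perturbation of $\mathcal{A}$) with $\Delta_{\mathcal{A}}=\|P_{\mathcal{A}}-P_{\hat{\mathcal{A}}}\|_{F\to F}$. Let $$\tau:=\frac16-n^2\rho_2-(n^2+n)\rho_n\qquad\text{and}\qquad \Delta_0:=\frac{2\tau}{2+4\tau+3n^2}.$$ Then, if $\Delta_{\mathcal{A}}<\Delta_0$, the program $\max_{x\in\mathbb{S}^{D-1}}F_{\hat{\mathcal{A}}}(x)$ has exactly $2K$ second-order critical points in the superlevel set where $$F_{\hat{\mathcal{A}}}(x)\ \ge\ \frac{2+2\tau+3n^2}{2\tau}\,\Delta_{\mathcal{A}}.$$ Each of these critical points is a strict local maximizer for $F_{\hat{\mathcal{A}}}$ (on $\mathbb{S}^{D-1}$). Further, for each such point $x^*$, there exist unique $i\in[K]$ and $s\in\{-1,1\}$ such that $$\|x^*-sa_i\|_2^2\le \frac{2\Delta_{\mathcal{A}}}{n}.$$ In the noiseless case ($\Delta_{\mathcal{A}}=0$), if $\tau\ge 0$ then there are precisely $2K$ second-order critical points of $\max_{x\in\mathbb{S}^{D-1}}F_{\mathcal{A}}(x)$ with positive functional value, and they are the global maximizers $sa_i$ ($i\in[K]$, $s\in\{-1,1\}$).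
   Context: $[K]=\{1,\dots,K\}$; $\mathbb{S}^{D-1}$ is the unit sphere of $\mathbb{R}^D$. $(\mathbb{R}^D)^{\otimes n}$ is the space of real tensors of size $D^{\times n}$ with Frobenius inner product $\langle\cdot,\cdot\rangle$ and norm $\|\cdot\|_F$; $\operatorname{Sym}((\mathbb{R}^D)^{\otimes n})$ is the subspace of symmetric tensors. For a linear subspace $\mathcal{B}$ of tensors, $P_{\mathcal{B}}$ is the orthogonal projector onto $\mathcal{B}$, and $F_{\mathcal{B}}(x):=\|P_{\mathcal{B}}(x^{\otimes n})\|_F^2$. $\|\cdot\|_{F\to F}$ is the operator norm induced by the Frobenius norm. For $s\in\mathbb{N}$, $\rho_s:=\sup_{x\in\mathbb{S}^{D-1}}\sum_{i=1}^K|\langle x,a_i\rangle|^s-1$. A point $x\in\mathbb{S}^{D-1}$ is second-order critical for $\max_{\mathbb{S}^{D-1}}F$ if the Riemannian gradient of $F|_{\mathbb{S}^{D-1}}$ vanishes at $x$ and the Riemannian Hessian at $x$ is negative semidefinite on the tangent space $\{z: z\perp x\}$.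
   Formalization: The noisy part assumes τ>0 (a very negative τ also makes Δ₀>0, and the claim can then fail), its superlevel set also requires F_Â(x)>0 (which matters only when Δ_A=0), and the identification of all global maximizers with the sa_i assumes K≥1. *)

(* Defs.v *)
From HB Require Import structures.
From mathcomp Require Import all_boot all_order all_algebra all_fingroup.
From mathcomp Require Import all_classical all_reals all_analysis.

Set Implicit Arguments.
Unset Strict Implicit.
Unset Printing Implicit Defensive.

Import Order.TTheory GRing.Theory Num.Theory.
Import numFieldNormedType.Exports.

Local Open Scope classical_set_scope.
Local Open Scope ring_scope.

(* [`|x|] on ['rV[R]_D] is the sup norm in MathComp-Analysis, hence a separate
   Euclidean norm; both induce the same topology. *)
Definition dotp (R : realType) (D : nat) (x y : 'rV[R]_D) : R :=
  \sum_(i < D) x 0 i * y 0 i.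

Definition enorm (R : realType) (D : nat) (x : 'rV[R]_D) : R :=
  Num.sqrt (dotp x x).

Definition sphere (R : realType) (D : nat) : set 'rV[R]_D :=
  [set x | enorm x = 1].

(* Entries are indexed by multi-indices [k : 'I_n -> 'I_D]; the codomain is the
   regular module [R^o], so that tensors form a [vectType R]. *)
Definition tensor (R : realType) (D n : nat) : vectType R :=
  {ffun {ffun 'I_n -> 'I_D} -> R^o}.

Definition frob (R : realType) (D n : nat) (S T : tensor R D n) : R :=
  \sum_(k : {ffun 'I_n -> 'I_D}) (S k : R) * (T k : R).

Definition frob_norm (R : realType) (D n : nat) (T : tensor R D n) : R :=
  Num.sqrt (frob T T).

Definition symmetric_tensor (R : realType) (D n : nat) (T : tensor R D n) : Prop :=
  forall (s : 'S_n) (k : {ffun 'I_n -> 'I_D}), T [ffun j => k (s j)] = T k.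

Definition tpow (R : realType) (D n : nat) (x : 'rV[R]_D) : tensor R D n :=
  [ffun k : {ffun 'I_n -> 'I_D} => \prod_(j < n) x 0 (k j)].

(* The unique [U] in [B] with [T - U] orthogonal to [B]. *)
Definition oproj (R : realType) (D n : nat) (B : {vspace tensor R D n})
    (T : tensor R D n) : tensor R D n :=
  xget 0 [set U | U \in B /\ forall V, V \in B -> frob (T - U) V = 0].

Definition opnorm (R : realType) (D n : nat) (L : tensor R D n -> tensor R D n) : R :=
  sup [set frob_norm (L T) | T in [set T | frob_norm T <= 1]].

Definition Fobj (R : realType) (D n : nat) (B : {vspace tensor R D n})
    (x : 'rV[R]_D) : R :=
  frob_norm (oproj B (tpow n x)) ^+ 2.

Definition egrad (R : realType) (D : nat) (f : 'rV[R]_D -> R) (x : 'rV[R]_D)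
    : 'rV[R]_D :=
  \row_(i < D) 'D_(delta_mx 0 i) f x.

(* For [x] on the sphere, the orthogonal projector onto the tangent space. *)
Definition tanproj (R : realType) (D : nat) (x v : 'rV[R]_D) : 'rV[R]_D :=
  v - dotp x v *: x.

Definition rgrad (R : realType) (D : nat) (f : 'rV[R]_D -> R) (x : 'rV[R]_D)
    : 'rV[R]_D :=
  tanproj x (egrad f x).

(* The Levi-Civita connection of the sphere is the tangential part of the
   ambient derivative; it is applied to [rgrad f], whose formula makes sense on
   the whole ambient space and extends the gradient field off the sphere. *)
Definition rhess (R : realType) (D : nat) (f : 'rV[R]_D -> R) (x z : 'rV[R]_D)
    : 'rV[R]_D :=
  tanproj x ('D_z (rgrad f) x).

Definition second_order_critical (R : realType) (D : nat) (f : 'rV[R]_D -> R)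
    (x : 'rV[R]_D) : Prop :=
  [/\ sphere x, rgrad f x = 0
    & forall z, dotp z x = 0 -> dotp z (rhess f x z) <= 0].

Definition strict_local_max (R : realType) (D : nat) (f : 'rV[R]_D -> R)
    (x : 'rV[R]_D) : Prop :=
  sphere x /\ \forall y \near x, sphere y -> y != x -> f y < f x.

Definition global_max (R : realType) (D : nat) (f : 'rV[R]_D -> R)
    (x : 'rV[R]_D) : Prop :=
  sphere x /\ forall y, sphere y -> f y <= f x.

Definition spanA (R : realType) (D n K : nat) (a : 'I_K -> 'rV[R]_D)
    : {vspace tensor R D n} :=
  <<[tuple tpow n (a i) | i < K]>>%VS.

Definition rho (R : realType) (D K : nat) (a : 'I_K -> 'rV[R]_D) (s : nat) : R :=
  sup [set \sum_(i < K) `|dotp x (a i)| ^+ s | x in @sphere R D] - 1.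

Definition tau (R : realType) (D n K : nat) (a : 'I_K -> 'rV[R]_D) : R :=
  6^-1 - n%:R ^+ 2 * rho a 2 - (n%:R ^+ 2 + n%:R) * rho a n.

(* Only meaningful for [0 < tau n a]: the quotient is also positive when [tau n a]
   is so negative that the denominator changes sign. *)
Definition Delta0 (R : realType) (D n K : nat) (a : 'I_K -> 'rV[R]_D) : R :=
  2 * tau n a / (2 + 4 * tau n a + 3 * n%:R ^+ 2).

Definition DeltaA (R : realType) (D n K : nat) (a : 'I_K -> 'rV[R]_D)
    (Ahat : {vspace tensor R D n}) : R :=
  opnorm (fun T => oproj (spanA n a) T - oproj Ahat T).

Definition level (R : realType) (D n K : nat) (a : 'I_K -> 'rV[R]_D)
    (Ahat : {vspace tensor R D n}) : R :=
  (2 + 2 * tau n a + 3 * n%:R ^+ 2) / (2 * tau n a) * DeltaA a Ahat.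

(* The condition [0 < Fobj Ahat x] is implied by the other one when
   [0 < tau n a] and [0 < DeltaA a Ahat].  It matters only when [DeltaA a Ahat]
   is 0: the level is then 0, and a point [x] orthogonal to every [a i] may be
   second-order critical with value 0 (e.g. for [n = 2] and [a] orthonormal
   with [K < D]). *)
Definition high_critical (R : realType) (D n K : nat) (a : 'I_K -> 'rV[R]_D)
    (Ahat : {vspace tensor R D n}) : set 'rV[R]_D :=
  [set x | [/\ second_order_critical (Fobj Ahat) x,
               level a Ahat <= Fobj Ahat x & 0 < Fobj Ahat x]].

(* Signs in {-1, 1} are encoded as [(-1) ^+ s] with [s : bool]. *)
Definition signed (R : realType) (D K : nat) (a : 'I_K -> 'rV[R]_D)
    (p : 'I_K * bool) : 'rV[R]_D :=
  (-1) ^+ p.2 *: a p.1.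

(* Main.v *)
Require Import Defs.
From mathcomp Require Import all_boot all_order all_algebra all_fingroup.
From mathcomp Require Import all_classical all_reals all_analysis.
From mathcomp Require Import ring lra zify.
Import Order.TTheory GRing.Theory Num.Theory.
Import numFieldNormedType.Exports.
Local Open Scope classical_set_scope.
Local Open Scope card_scope.
Local Open Scope ring_scope.

(* Write P, Q for the orthogonal projectors onto the span A and its perturbation,
   F for the objective of the perturbed problem, N = n, and fix on the sphere a
   second-order critical point x of high value.  Let a_i be the vector with the
   largest |<x, a_i>|, and d = 1 - <x, a_i>^2.  Testing the Hessian inequality in
   the direction of a_i - <x, a_i> x gives roughly (2N - 1) d <= 1: the Gram matrix
   of the tensors a_j^n is within rho_n of the identity in the sup norm, so P(x^n)
   has coefficients close to <x, a_j>^n.  Testing the gradient equation in the same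
   direction then forces d = O(Delta / N), as every other term carries a factor
   d times a constant < 1.  On such a small cap around a signed vector the gradient
   map x |-> Q(x^n) x^(n-1) is a contraction, while it equals F(x) x at critical
   points with F(x) close to 1; hence each cap contains at most one critical point.
   Conversely, maximizing F over a compact neighbourhood of a signed vector, on the
   boundary of which F is smaller than at the center, produces a critical point,
   which lies in the cap by the first part. *)

Set Implicit Arguments.
Unset Strict Implicit.
Unset Printing Implicit Defensive.

(** * Inner products and orthogonal projections *)

(** The obstacle is that M = <x, a_i>^(2(n - 1)), which scales both tested inequalities, may a
    priori be tiny, whereas the noise is measured absolutely. It is overcome by F(x) - Delta <= M (1
    + rho_2) / (1 - rho_n): cleared of denominators, the level condition reads (2 + 3 N^2) Delta <=
    2 tau (F(x) - Delta), so Delta is at most a small multiple of M, and M can be cancelled. The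
    same condition at the value F = 1 - Delta is the non-strict form of Delta < Delta_0, which is
    how the maximizers near the signed vectors, of value at least 1 - Delta, are seen to reach the
    level. Since the condition is never divided by tau, the noiseless case with tau = 0 goes through
    the same lemmas. The smallness of rho_2, rho_n and tau always comes from the budget N^2 rho_2 +
    (N^2 + N) rho_n + tau = 1/6 together with N >= 2. *)

Section FiniteSums.
Variables (R : realType) (I : finType).
Implicit Types f g : I -> R.

Lemma cauchy_schwarz_sum (P : pred I) f g :
  (\sum_(i | P i) f i * g i) ^+ 2 <=
  (\sum_(i | P i) f i ^+ 2) * (\sum_(i | P i) g i ^+ 2).
Proof.
set A := \sum_(i | P i) f i ^+ 2; set B := \sum_(i | P i) g i ^+ 2.
set C := \sum_(i | P i) f i * g i.
have B0 : 0 <= B by apply: sumr_ge0 => i _; exact: sqr_ge0.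
(* The form is evaluated at [(B, C)] below, where it equals [B * (A * B - C ^+ 2)]. *)
have E (s t : R) : 0 <= s ^+ 2 * A - 2 * s * t * C + t ^+ 2 * B.
  have -> : s ^+ 2 * A - 2 * s * t * C + t ^+ 2 * B
          = \sum_(i | P i) (s * f i - t * g i) ^+ 2.
    rewrite /A /B /C !mulr_sumr -sumrB -big_split /=.
    by apply: eq_bigr => i _; ring.
  by apply: sumr_ge0 => i _; exact: sqr_ge0.
have [B_gt0|] := ltP 0 B.
  have := E B C; rewrite (_ : _ + _ = B * (A * B - C ^+ 2)); last by ring.
  by rewrite pmulr_rge0 // subr_ge0.
move=> Ble; have B_0 : B = 0 by apply/eqP; rewrite eq_le Ble B0.
have gi0 i : P i -> g i = 0.
  move=> Pi; apply/eqP; rewrite -sqrf_eq0; apply/eqP.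
  have /eqP := B_0; rewrite psumr_eq0; last by move=> j _; exact: sqr_ge0.
  by move=> /allP /(_ i (mem_index_enum i)); rewrite Pi => /eqP.
rewrite B_0 mulr0 /C big1 ?expr0n // => i Pi.
by rewrite gi0 // mulr0.
Qed.

Lemma sum_norm_le (P : pred I) f g X Y :
    0 <= X -> 0 <= Y ->
    \sum_(i | P i) f i ^+ 2 <= X ^+ 2 -> \sum_(i | P i) g i ^+ 2 <= Y ^+ 2 ->
  \sum_(i | P i) `|f i| * `|g i| <= X * Y.
Proof.
move=> X0 Y0 hX hY.
rewrite -ler_sqr ?nnegrE ?mulr_ge0 //; last first.
  by apply: sumr_ge0 => i _; rewrite mulr_ge0.
apply: (le_trans (cauchy_schwarz_sum P (fun i => `|f i|) (fun i => `|g i|))).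
rewrite exprMn; apply: ler_pM.
- by apply: sumr_ge0 => i _; exact: sqr_ge0.
- by apply: sumr_ge0 => i _; exact: sqr_ge0.
- by under eq_bigr do rewrite real_normK ?num_real //.
- by under eq_bigr do rewrite real_normK ?num_real //.
Qed.

End FiniteSums.

Section Vectors.
Variables (R : realType) (D : nat).
Implicit Types (x y z : 'rV[R]_D) (c : R).

Lemma dotpC x y : dotp x y = dotp y x.
Proof. by apply: eq_bigr => i _; rewrite mulrC. Qed.

Lemma dotpDl x y z : dotp (x + y) z = dotp x z + dotp y z.
Proof. by rewrite -big_split /=; apply: eq_bigr => i _; rewrite mxE mulrDl. Qed.

Lemma dotpZl c x y : dotp (c *: x) y = c * dotp x y.
Proof. by rewrite mulr_sumr; apply: eq_bigr => i _; rewrite mxE mulrA. Qed.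

Lemma dotpNl x y : dotp (- x) y = - dotp x y.
Proof. by rewrite -scaleN1r dotpZl mulN1r. Qed.

Lemma dotpBl x y z : dotp (x - y) z = dotp x z - dotp y z.
Proof. by rewrite dotpDl dotpNl. Qed.

Lemma dotpDr x y z : dotp x (y + z) = dotp x y + dotp x z.
Proof. by rewrite dotpC dotpDl !(dotpC x). Qed.

Lemma dotpZr c x y : dotp x (c *: y) = c * dotp x y.
Proof. by rewrite dotpC dotpZl (dotpC x). Qed.

Lemma dotpNr x y : dotp x (- y) = - dotp x y.
Proof. by rewrite dotpC dotpNl (dotpC x). Qed.

Lemma dotpBr x y z : dotp x (y - z) = dotp x y - dotp x z.
Proof. by rewrite dotpDr dotpNr. Qed.

Lemma dotp0l x : dotp 0 x = 0.
Proof. by rewrite -(scale0r (0 : 'rV_D)) dotpZl mul0r. Qed.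

Definition dotpE := (dotpDl, dotpBl, dotpNl, dotpZl, dotpDr, dotpBr, dotpNr, dotpZr).

Lemma dotp_ge0 x : 0 <= dotp x x.
Proof. by apply: sumr_ge0 => i _; rewrite -expr2 sqr_ge0. Qed.

Lemma dotp_eq0 x : dotp x x = 0 -> x = 0.
Proof.
move=> /eqP; rewrite psumr_eq0; last by move=> i _; rewrite -expr2 sqr_ge0.
move=> /allP h; apply/rowP => i; rewrite mxE.
by have := h i (mem_index_enum i); rewrite -expr2 sqrf_eq0 => /eqP.
Qed.

Lemma dotp_CS x y : dotp x y ^+ 2 <= dotp x x * dotp y y.
Proof.
have := cauchy_schwarz_sum predT (fun i => x 0 i) (fun i => y 0 i).
by under eq_bigr do rewrite mulrC; rewrite -/(dotp y x) dotpC.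
Qed.

Lemma enorm_sqr x : enorm x ^+ 2 = dotp x x.
Proof. by rewrite sqr_sqrtr // dotp_ge0. Qed.

Lemma enorm_ge0 x : 0 <= enorm x. Proof. exact: sqrtr_ge0. Qed.

Lemma sphereE x : sphere x <-> dotp x x = 1.
Proof.
split=> [h|h]; first by rewrite -enorm_sqr [enorm x]h expr1n.
by rewrite /sphere /= /enorm h sqrtr1.
Qed.

Lemma dotp_norm_le x y : `|dotp x y| <= enorm x * enorm y.
Proof.
rewrite -ler_sqr ?nnegrE ?mulr_ge0 ?enorm_ge0 //.
by rewrite real_normK ?num_real // exprMn !enorm_sqr dotp_CS.
Qed.

Lemma dotp_sphere_le1 x y : sphere x -> sphere y -> `|dotp x y| <= 1.
Proof.
by move=> hx hy; have := dotp_norm_le x y; rewrite [enorm x]hx [enorm y]hy mulr1.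
Qed.

End Vectors.

Section Tensors.
Variables (R : realType) (D n : nat).
Local Notation tens := (tensor R D n).
Implicit Types (S T U V : tens) (c : R) (B : {vspace tens}).

Lemma tensD S T k : (S + T) k = (S k : R) + (T k : R) :> R.
Proof. by rewrite [LHS]ffunE. Qed.

Lemma tensZ c T k : (c *: T) k = c * (T k : R) :> R.
Proof. by rewrite [LHS]ffunE. Qed.

Lemma frobC S T : frob S T = frob T S.
Proof. by apply: eq_bigr => i _; rewrite mulrC. Qed.

Lemma frobDl S T U : frob (S + T) U = frob S U + frob T U.
Proof. by rewrite -big_split /=; apply: eq_bigr => i _; rewrite tensD mulrDl. Qed.

Lemma frobZl c S T : frob (c *: S) T = c * frob S T.
Proof. by rewrite mulr_sumr; apply: eq_bigr => i _; rewrite tensZ mulrA. Qed.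

Lemma frobNl S T : frob (- S) T = - frob S T.
Proof. by rewrite -scaleN1r frobZl mulN1r. Qed.

Lemma frobBl S T U : frob (S - T) U = frob S U - frob T U.
Proof. by rewrite frobDl frobNl. Qed.

Lemma frobDr S T U : frob S (T + U) = frob S T + frob S U.
Proof. by rewrite frobC frobDl !(frobC S). Qed.

Lemma frobZr c S T : frob S (c *: T) = c * frob S T.
Proof. by rewrite frobC frobZl (frobC S). Qed.

Lemma frobNr S T : frob S (- T) = - frob S T.
Proof. by rewrite frobC frobNl (frobC S). Qed.

Lemma frobBr S T U : frob S (T - U) = frob S T - frob S U.
Proof. by rewrite frobDr frobNr. Qed.

Lemma frob0l T : frob 0 T = 0.
Proof. by rewrite -(scale0r (0 : tens)) frobZl mul0r. Qed.

Lemma frob0r T : frob T 0 = 0.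
Proof. by rewrite frobC frob0l. Qed.

Lemma frob_suml (I : finType) (P : pred I) (F : I -> tens) T :
  frob (\sum_(i | P i) F i) T = \sum_(i | P i) frob (F i) T.
Proof.
by elim/big_rec2: _ => [|i u S _ <-]; [exact: frob0l | rewrite frobDl].
Qed.

Lemma frob_sumr (I : finType) (P : pred I) (F : I -> tens) T :
  frob T (\sum_(i | P i) F i) = \sum_(i | P i) frob T (F i).
Proof. by rewrite frobC frob_suml; apply: eq_bigr => i _; rewrite frobC. Qed.

Lemma frob_ge0 T : 0 <= frob T T.
Proof. by apply: sumr_ge0 => i _; rewrite -expr2 sqr_ge0. Qed.

Lemma frob_eq0 T : frob T T = 0 -> T = 0.
Proof.
move=> /eqP; rewrite psumr_eq0; last by move=> i _; rewrite -expr2 sqr_ge0.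
move=> /allP h; apply/ffunP => k; rewrite ffunE.
by have := h k (mem_index_enum k); rewrite -expr2 sqrf_eq0 => /eqP.
Qed.

Lemma frob_CS S T : frob S T ^+ 2 <= frob S S * frob T T.
Proof.
have := cauchy_schwarz_sum predT (fun k => S k : R) (fun k => T k : R).
by under eq_bigr do rewrite mulrC; rewrite -/(frob T S) frobC.
Qed.

Lemma frob_norm_ge0 T : 0 <= frob_norm T. Proof. exact: sqrtr_ge0. Qed.

Lemma frob_norm_sqr T : frob_norm T ^+ 2 = frob T T.
Proof. by rewrite sqr_sqrtr // frob_ge0. Qed.

Lemma frob_normZ c T : frob_norm (c *: T) = `|c| * frob_norm T.
Proof.
by rewrite /frob_norm frobZl frobZr mulrA -expr2 sqrtrM ?sqr_ge0 // sqrtr_sqr.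
Qed.

Lemma frob_abs_le S T : `|frob S T| <= frob_norm S * frob_norm T.
Proof.
rewrite -ler_sqr ?nnegrE ?mulr_ge0 ?frob_norm_ge0 //.
by rewrite real_normK ?num_real // exprMn !frob_norm_sqr frob_CS.
Qed.

Lemma frob_norm_triangle S T : frob_norm (S + T) <= frob_norm S + frob_norm T.
Proof.
rewrite -ler_sqr ?nnegrE ?addr_ge0 ?frob_norm_ge0 //.
rewrite frob_norm_sqr frobDl !frobDr (frobC T S).
have := le_trans (ler_norm _) (frob_abs_le S T).
by have := frob_norm_sqr S; have := frob_norm_sqr T; lra.
Qed.

Lemma frob_norm_sum (I : finType) (P : pred I) (F : I -> tens) :
  frob_norm (\sum_(i | P i) F i) <= \sum_(i | P i) frob_norm (F i).
Proof.
elim/big_rec2: _ => [|i u S _ h]; first by rewrite /frob_norm frob0l sqrtr0.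
by apply: (le_trans (frob_norm_triangle _ _)); rewrite lerD2l.
Qed.

Lemma frob_norm_le T b : 0 <= b -> frob T T <= b ^+ 2 -> frob_norm T <= b.
Proof.
by move=> b0 h; rewrite -ler_sqr ?nnegrE ?frob_norm_ge0 // frob_norm_sqr.
Qed.

(** Gram-Schmidt by induction on the generators: only the component [w] of the new generator
    orthogonal to the earlier span contributes. Existence ensures that the choice made in [oproj]
    never falls back on its default. *)
Lemma orthogonal_decomposition (X : seq tens) T :
  exists U, U \in <<X>>%VS /\ forall V, V \in <<X>>%VS -> frob (T - U) V = 0.
Proof.
elim: X T => [|v X IH] T.
  exists 0; split; first exact: mem0v.
  by move=> V; rewrite span_nil memv0 => /eqP ->; exact: frob0r.
have [v1 [v1X v1o]] := IH v; have [U [UX Uo]] := IH T.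
(* If [frob w w] is 0 then [w] is 0, and the quotient by 0 multiplies a zero tensor. *)
set w := v - v1; pose c := frob (T - U) w / frob w w.
exists (U + c *: w); split.
  rewrite span_cons memvD //.
    by apply: subvP UX; exact: addvSr.
  rewrite memvZ // memvB //.
    by apply: (subvP (addvSl _ _)); exact: memv_line.
  by apply: (subvP (addvSr _ _)).
move=> V; rewrite span_cons => /memv_addP [_ /vlineP [d ->] [V2 V2X ->]].
have -> : d *: v + V2 = d *: w + (d *: v1 + V2) by rewrite addrA -scalerDr subrK.
have VX : d *: v1 + V2 \in <<X>>%VS by rewrite memvD // memvZ.
rewrite opprD addrA frobDr frobZr !frobDl !frobNl !frobZl (v1o _ VX).
have := Uo _ VX; rewrite frobDl frobNl => ->.
rewrite mulr0 subr0 addr0.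
have -> : frob T w - frob U w = frob (T - U) w by rewrite frobBl.
rewrite /c; have [w0|w0] := eqVneq (frob w w) 0; last by rewrite divfK // subrr mulr0.
by rewrite (frob_eq0 w0) !frob0r mulr0 subr0 mulr0.
Qed.

Lemma oprojP B T :
  oproj B T \in B /\ forall V, V \in B -> frob (T - oproj B T) V = 0.
Proof.
have [U hU] := orthogonal_decomposition (vbasis B) T.
rewrite (span_basis (vbasisP B)) in hU.
by rewrite /oproj; case: xgetP => [_ -> //|/(_ U)/(_ hU)].
Qed.

Lemma oproj_mem B T : oproj B T \in B. Proof. by case: (oprojP B T). Qed.

Lemma oproj_orth B T V : V \in B -> frob (oproj B T) V = frob T V.
Proof.
by move=> VB; case: (oprojP B T) => _ /(_ _ VB); rewrite frobBl => /eqP;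
  rewrite subr_eq0 => /eqP.
Qed.

Lemma oproj_uniq B T U :
  U \in B -> (forall V, V \in B -> frob U V = frob T V) -> oproj B T = U.
Proof.
move=> UB hU; apply/eqP; rewrite -subr_eq0; apply/eqP/frob_eq0.
have dB : oproj B T - U \in B by rewrite memvB // oproj_mem.
by rewrite frobBl (oproj_orth _ dB) (hU _ dB) subrr.
Qed.

Lemma oprojD B S T : oproj B (S + T) = oproj B S + oproj B T.
Proof.
apply: oproj_uniq; first by rewrite memvD // oproj_mem.
by move=> V VB; rewrite !frobDl !oproj_orth.
Qed.

Lemma oprojZ B c T : oproj B (c *: T) = c *: oproj B T.
Proof.
apply: oproj_uniq; first by rewrite memvZ // oproj_mem.
by move=> V VB; rewrite !frobZl !oproj_orth.
Qed.

Lemma oprojB B S T : oproj B (S - T) = oproj B S - oproj B T.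
Proof. by rewrite oprojD -(scaleN1r T) oprojZ scaleN1r. Qed.

Lemma frob_oproj B S T : frob (oproj B S) (oproj B T) = frob (oproj B S) T.
Proof. by rewrite frobC oproj_orth ?oproj_mem // frobC. Qed.

Lemma oproj_sym B S T : frob (oproj B S) T = frob S (oproj B T).
Proof. by rewrite -(frob_oproj B S T) (frobC (oproj B S)) frob_oproj frobC. Qed.

Lemma oproj_norm_le B T : frob_norm (oproj B T) <= frob_norm T.
Proof.
have [->|h] := eqVneq (frob_norm (oproj B T)) 0; first exact: frob_norm_ge0.
have h0 : 0 < frob_norm (oproj B T) by rewrite lt_def h frob_norm_ge0.
rewrite -(ler_pM2l h0) -expr2 frob_norm_sqr frob_oproj.
exact: le_trans (ler_norm _) (frob_abs_le _ _).
Qed.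

(** Bessel's inequality for a single unit tensor; it is applied to one power [tpow n (a i)] of the
    frame and drops all the others. *)
Lemma frob_oproj_ge B T V : V \in B -> frob V V = 1 ->
  frob T V ^+ 2 <= frob (oproj B T) T.
Proof.
move=> VB V1; rewrite -(oproj_orth _ VB) -(frob_oproj B T T).
by have := frob_CS (oproj B T) V; rewrite V1 mulr1.
Qed.

End Tensors.

(** * Powers of vectors and their derivatives *)

(** Bernoulli's inequality, in the range where every power of [c] in the factorization of
    [1 - c ^+ n] is at most 1. *)
Lemma one_sub_exp_le (R : realType) (n : nat) (c : R) :
  `|c| <= 1 -> 1 - c ^+ n <= n%:R * (1 - c).
Proof.
move=> c1; have c2 : c <= 1 by apply: le_trans c1; exact: ler_norm.
rewrite -[X in X - _](expr1n _ n) subrXX mulrC; apply: ler_wpM2r.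
  by rewrite subr_ge0.
rewrite -[X in _ <= X%:R]card_ord -sumr_const; apply: ler_sum => i _.
by rewrite expr1n mul1r (le_trans (ler_norm _)) // normrX exprn_ile1.
Qed.

Lemma leq_sqr_self (n : nat) : (n <= n ^ 2)%N.
Proof. by case: n => // n; rewrite -mulnn leq_pmulr. Qed.

Section TensorPowers.
Variables (R : realType) (D n : nat).
Local Notation tens := (tensor R D n).
Implicit Types (x y z w a : 'rV[R]_D) (c t : R).

(** Elementary tensors with possibly different factors: the derivatives of [tpow] along a line are
    sums of these, and their inner products factorize. *)
Definition prodtens (f : 'I_n -> 'rV[R]_D) : tens :=
  [ffun k : {ffun 'I_n -> 'I_D} => \prod_(j < n) f j 0 (k j)].

Lemma prodtensE f k : prodtens f k = \prod_(j < n) f j 0 (k j) :> R.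
Proof. by rewrite ffunE. Qed.

Lemma frob_prodtens f g :
  frob (prodtens f) (prodtens g) = \prod_(j < n) dotp (f j) (g j).
Proof.
rewrite /dotp bigA_distr_bigA /=; apply: eq_bigr => k _.
by rewrite !prodtensE -big_split.
Qed.

Lemma tpow_prodtens x : tpow n x = prodtens (fun=> x).
Proof. by []. Qed.

Lemma frob_tpow x y : frob (tpow n x) (tpow n y) = dotp x y ^+ n.
Proof. by rewrite !tpow_prodtens frob_prodtens big_const_ord iter_mulr_1. Qed.

Lemma tpowZ c x : tpow n (c *: x) = c ^+ n *: tpow n x.
Proof.
apply/ffunP => k; rewrite [RHS]tensZ !ffunE.
under eq_bigr do rewrite mxE.
by rewrite big_split /= big_const_ord iter_mulr_1.
Qed.

Definition put1 x z (j l : 'I_n) := if l == j then z else x.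
Definition put2 x z (j k l : 'I_n) := if (l == j) || (l == k) then z else x.

(* First and second derivatives at [t = 0] of [tpow n (x + t *: z)]. *)
Definition dtpow x z : tens := \sum_(j < n) prodtens (put1 x z j).
Definition d2tpow x z : tens :=
  \sum_(j < n) \sum_(k < n | k != j) prodtens (put2 x z j k).

Lemma card_neq1 (j : 'I_n) : #|[pred l | l != j]| = n.-1.
Proof. by rewrite -[in RHS](card_ord n) -(cardC1 j); apply: eq_card. Qed.

Lemma card_neq2 (j k : 'I_n) : k != j -> #|[pred l | (l != j) && (l != k)]| = n.-2.
Proof.
move=> kj; rewrite -(card_neq1 j).
suff -> : #|[pred l | l != j]| = #|[pred l | (l != j) && (l != k)]|.+1 by [].
rewrite (cardD1 k) inE kj; congr S.
by apply: eq_card => l; rewrite !inE andbC.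
Qed.

Lemma prod_if1 (V : comPzRingType) (j : 'I_n) (u v : V) :
  \prod_(l < n) (if l == j then u else v) = u * v ^+ n.-1.
Proof.
rewrite (bigD1 j) //= eqxx; congr (_ * _).
rewrite (eq_bigr (fun=> v)) => [|l /negbTE -> //].
by rewrite prodr_const card_neq1.
Qed.

Lemma prod_if2 (V : comPzRingType) (j k : 'I_n) (u v : V) : k != j ->
  \prod_(l < n) (if (l == j) || (l == k) then u else v) = u ^+ 2 * v ^+ n.-2.
Proof.
move=> kj; rewrite (bigD1 j) //= eqxx (bigD1 k) //= eqxx orbT mulrA -expr2.
congr (_ * _).
rewrite (eq_bigr (fun=> v)) => [|l /andP[/negbTE -> /negbTE -> //]].
by rewrite prodr_const card_neq2.
Qed.

Lemma frob_dtpow x z a :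
  frob (dtpow x z) (tpow n a) = n%:R * (dotp x a ^+ n.-1 * dotp z a).
Proof.
rewrite frob_suml (eq_bigr (fun=> dotp x a ^+ n.-1 * dotp z a)) => [|j _].
  by rewrite big_const_ord iter_addr_0 mulr_natl.
rewrite tpow_prodtens frob_prodtens.
rewrite (eq_bigr (fun l => if l == j then dotp z a else dotp x a)) => [|l _].
  by rewrite prod_if1 mulrC.
by rewrite /put1; case: ifP.
Qed.

Lemma frob_d2tpow x z a :
  frob (d2tpow x z) (tpow n a)
  = n%:R * n.-1%:R * (dotp x a ^+ n.-2 * dotp z a ^+ 2).
Proof.
rewrite frob_suml.
rewrite (eq_bigr (fun=> n.-1%:R * (dotp x a ^+ n.-2 * dotp z a ^+ 2))) => [|j _].
  by rewrite big_const_ord iter_addr_0 -[LHS]mulr_natl mulrA.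
rewrite frob_suml.
rewrite (eq_bigr (fun=> dotp x a ^+ n.-2 * dotp z a ^+ 2)) => [|k kj].
  by rewrite sumr_const card_neq1 mulr_natl.
rewrite tpow_prodtens frob_prodtens.
rewrite (eq_bigr (fun l => if (l == j) || (l == k) then dotp z a else dotp x a)).
  by rewrite prod_if2 // mulrC.
by move=> l _; rewrite /put2; case: ifP.
Qed.

(** For a tangent direction the [n] summands are pairwise orthogonal, because slot [j] pairs [z]
    with [x]. This gains a factor [n] in the square over the triangle inequality of
    [frob_norm_dtpow], and sets the size of the noise terms at tangent test vectors. *)
Lemma frob_dtpow_tangent x z : sphere x -> dotp z x = 0 ->
  frob (dtpow x z) (dtpow x z) = n%:R * dotp z z.
Proof.
move=> /sphereE x1 zx; rewrite frob_suml.
rewrite (eq_bigr (fun=> dotp z z)) => [|j _].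
  by rewrite big_const_ord iter_addr_0 mulr_natl.
rewrite frob_sumr (bigD1 j) //= [X in _ + X]big1 ?addr0 => [|k kj].
  rewrite frob_prodtens.
  rewrite (eq_bigr (fun l => if l == j then dotp z z else 1)).
    by rewrite prod_if1 expr1n mulr1.
  by move=> l _; rewrite /put1; case: ifP.
by rewrite frob_prodtens (bigD1 j) //= /put1 eqxx eq_sym (negbTE kj) zx mul0r.
Qed.

Lemma frob_norm_dtpow x z : sphere x -> frob_norm (dtpow x z) <= n%:R * enorm z.
Proof.
move=> /sphereE x1; apply: (le_trans (frob_norm_sum _ _)).
rewrite mulr_natl -[X in _ *+ X]card_ord -sumr_const; apply: ler_sum => j _.
rewrite /frob_norm frob_prodtens.
rewrite (eq_bigr (fun l => if l == j then dotp z z else 1)).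
  by rewrite prod_if1 expr1n mulr1.
by move=> l _; rewrite /put1; case: ifP.
Qed.

Lemma frob_norm_d2tpow x z : sphere x ->
  frob_norm (d2tpow x z) <= n%:R * n.-1%:R * dotp z z.
Proof.
move=> /sphereE x1; apply: (le_trans (frob_norm_sum _ _)).
rewrite -mulrA [leRHS]mulr_natl -[X in _ *+ X]card_ord -sumr_const.
apply: ler_sum => j _; apply: (le_trans (frob_norm_sum _ _)).
have -> : n.-1%:R * dotp z z = \sum_(k < n | k != j) dotp z z.
  by rewrite sumr_const card_neq1 mulr_natl.
apply: ler_sum => k kj.
rewrite /frob_norm frob_prodtens.
rewrite (eq_bigr (fun l => if (l == j) || (l == k) then dotp z z else 1)).
  by rewrite prod_if2 // expr1n mulr1 sqrtr_sqr ger0_norm // dotp_ge0.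
by move=> l _; rewrite /put2; case: ifP.
Qed.

Lemma dtpow_lin x c z w : dtpow x (c *: z + w) = c *: dtpow x z + dtpow x w.
Proof.
rewrite scaler_sumr -big_split /=; apply: eq_bigr => j _.
apply/ffunP => k; rewrite [RHS]tensD tensZ !prodtensE.
rewrite !(bigD1 (P := predT) j) //= /put1 eqxx !mxE.
rewrite mulrDl mulrA; congr (_ + _); congr (_ * _).
  by apply: eq_bigr => l /negbTE ->.
by apply: eq_bigr => l /negbTE ->.
Qed.

Lemma dtpow_self x : dtpow x x = n%:R *: tpow n x.
Proof.
rewrite /dtpow (eq_bigr (fun=> tpow n x)) => [|j _].
  by rewrite big_const_ord iter_addr_0 scaler_nat.
by apply/ffunP => k; rewrite !ffunE; apply: eq_bigr => l _; rewrite /put1 if_same.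
Qed.

(** Both powers are unit tensors, so the squared distance is [2 * (1 - c ^+ n)] with [c = dotp x y];
    Bernoulli compares it with [n * (2 - 2 * c)], where [2 - 2 * c] is the squared distance of the
    points. *)
Lemma frob_norm_tpowB x y : sphere x -> sphere y ->
  frob_norm (tpow n x - tpow n y) <= n%:R * enorm (x - y).
Proof.
move=> hx hy; apply: frob_norm_le; first by rewrite mulr_ge0 // enorm_ge0.
rewrite exprMn enorm_sqr !frobBl !frobBr !frob_tpow !dotpE.
move/sphereE: (hx) => ->; move/sphereE: (hy) => ->; rewrite (dotpC y) expr1n.
have h := one_sub_exp_le n (dotp_sphere_le1 hx hy).
have h1 := dotp_sphere_le1 hx hy.
have h2 : dotp x y <= 1 by apply: le_trans h1; exact: ler_norm.
have h3 : n%:R <= n%:R ^+ 2 :> R by rewrite -natrX ler_nat leq_sqr_self.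
have := ler_wpM2r (_ : 0 <= 1 - dotp x y) h3; rewrite subr_ge0 => /(_ h2).
lra.
Qed.

Lemma frob_norm_dtpowB x y w : sphere x -> sphere y ->
  frob_norm (dtpow x w - dtpow y w) <= n%:R ^+ 2 * (enorm (x - y) * enorm w).
Proof.
move=> hx hy; rewrite -sumrB expr2 -mulrA mulr_natl -[X in _ *+ X]card_ord.
rewrite -sumr_const; apply: (le_trans (frob_norm_sum _ _)).
apply: ler_sum => j _; apply: frob_norm_le.
  by rewrite !mulr_ge0 // enorm_ge0.
rewrite !frobBl !frobBr !frob_prodtens.
have E (u v : 'rV_D) : \prod_(l < n) dotp (put1 u w j l) (put1 v w j l)
    = dotp w w * dotp u v ^+ n.-1.
  rewrite -(prod_if1 j); apply: eq_bigr => l _; rewrite /put1; by case: ifP.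
rewrite !E !exprMn !enorm_sqr !dotpE.
move/sphereE: (hx) => ->; move/sphereE: (hy) => ->; rewrite (dotpC y) expr1n.
have h := one_sub_exp_le n.-1 (dotp_sphere_le1 hx hy).
have h1 := dotp_sphere_le1 hx hy.
have h2 : dotp x y <= 1 by apply: le_trans h1; exact: ler_norm.
have h3 : n.-1%:R <= n%:R ^+ 2 :> R.
  by rewrite -natrX ler_nat (leq_trans (leq_pred n)) // leq_sqr_self.
have := ler_wpM2r (_ : 0 <= 1 - dotp x y) h3; rewrite subr_ge0 => /(_ h2).
have w0 := dotp_ge0 w.
set N := n%:R ^+ 2 in h3 *; set c := dotp x y in h h2 *.
move=> h4; have : dotp w w * (1 - c ^+ n.-1) <= dotp w w * (N * (1 - c)).
  by apply: ler_wpM2l => //; lra.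
lra.
Qed.

End TensorPowers.

(** * Gradient and Hessian of the objective *)

Section PolynomialDerivatives.
Variable R : realType.

Lemma deriv_prod_uniq (I : eqType) (s : seq I) (p : I -> {poly R}) : uniq s ->
  (\prod_(i <- s) p i)^`()
  = \sum_(i <- s) (p i)^`() * \prod_(j <- s | j != i) p j.
Proof.
elim: s => [|i s IH] /=; first by rewrite !big_nil -[1]/(1%:P) derivC.
move=> /andP[is_ us]; rewrite !big_cons derivM IH // eqxx /=.
congr (_ * _ + _).
  rewrite big_seq [RHS]big_seq_cond; apply: eq_bigl => j.
  by case: (boolP (j \in s)) => //= js; apply/esym; apply: contraNneq is_ => <-.
rewrite mulr_sumr [LHS]big_seq [RHS]big_seq; apply: eq_bigr => j js.
rewrite big_cons ifT; last by apply: contraNneq is_ => ->.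
by rewrite mulrCA.
Qed.

Lemma deriv_prod (I : finType) (P : pred I) (p : I -> {poly R}) :
  (\prod_(i | P i) p i)^`()
  = \sum_(i | P i) (p i)^`() * \prod_(j | P j && (j != i)) p j.
Proof.
rewrite -big_filter deriv_prod_uniq ?filter_uniq ?index_enum_uniq //.
by rewrite big_filter; apply: eq_bigr => i _; rewrite big_filter_cond.
Qed.

(** The analytic derivative sees only the function, so no identity of formal polynomials has to be
    established. *)
Lemma eq_horner_deriv (p q : {poly R}) (t : R) :
  (forall s, p.[s] = q.[s]) -> p^`().[t] = q^`().[t].
Proof.
by move=> h; rewrite !derivE; congr (_ t); congr (_^`()%classic); apply/funext.
Qed.

(** Restricted to a line, the objective and the coordinates of its gradient are polynomials in [t];
    the difference quotients of [f] and of [p] are then the same function, and all calculus reduces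
    to formal derivation. *)
Lemma is_derive_line (D : nat) (f : 'rV[R]_D -> R) (x z : 'rV[R]_D) (p : {poly R}) :
  (forall t, f (x + t *: z) = p.[t]) -> is_derive x z f p^`().[0].
Proof.
move=> h; have E : (fun t : R => t^-1 *: ((f \o shift x) (t *: z) - f x))
    = (fun t : R => t^-1 *: ((horner p \o shift 0) (t *: 1) - horner p 0)).
  apply/funext => t /=; rewrite -(h 0) scale0r !addr0 [t *: 1]mulr1 -h.
  by rewrite [t *: z + x]addrC.
have [d e] := is_derive_poly p 0.
by split; [rewrite /derivable E | rewrite -e /derive E].
Qed.

End PolynomialDerivatives.

Section Calculus.
Variables (R : realType) (D n : nat) (B : {vspace tensor R D n}).
Local Notation tens := (tensor R D n).
Local Notation idx := {ffun 'I_n -> 'I_D}.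
Local Notation Pt x := (oproj B (tpow n x)).
Implicit Types (x y z w : 'rV[R]_D) (t : R) (S T : tens).

Definition basist (k : idx) : tens := [ffun l => (l == k)%:R].

Lemma tens_basis T : T = \sum_k (T k : R) *: basist k.
Proof.
apply/ffunP => l; rewrite sum_ffunE (bigD1 l) //= big1 ?addr0 => [|k kl].
  by rewrite tensZ ffunE eqxx mulr1.
by rewrite tensZ ffunE eq_sym (negbTE kl) mulr0.
Qed.

Definition projmx (k l : idx) : R := frob (oproj B (basist k)) (basist l).

Lemma frob_oproj_sum S T :
  frob (oproj B S) T = \sum_k \sum_l projmx k l * ((S k : R) * (T l : R)).
Proof.
rewrite oproj_sym {1}(tens_basis S) frob_suml; apply: eq_bigr => k _.
rewrite -oproj_sym oprojZ frobZl {1}(tens_basis T) frob_sumr mulr_sumr.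
by apply: eq_bigr => l _; rewrite frobZr -/(projmx k l) mulrA mulrC.
Qed.

(** A curve of tensors with polynomial entries; differentiation in the tensor space becomes
    entrywise formal derivation. *)
Definition polytens := idx -> {poly R}.
Definition evalt (p : polytens) t : tens := [ffun k => (p k).[t]].
Definition dert (p : polytens) : polytens := fun k => (p k)^`().

Definition qform (p q : polytens) : {poly R} :=
  \sum_k \sum_l (projmx k l)%:P * (p k * q l).

Lemma qform_horner p q t :
  (qform p q).[t] = frob (oproj B (evalt p t)) (evalt q t).
Proof.
rewrite frob_oproj_sum horner_sum; apply: eq_bigr => k _.
rewrite horner_sum; apply: eq_bigr => l _.
by rewrite !hornerM hornerC !ffunE.
Qed.

Lemma qform_deriv p q : (qform p q)^`() = qform (dert p) q + qform p (dert q).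
Proof.
rewrite raddf_sum -big_split /=; apply: eq_bigr => k _.
rewrite raddf_sum -big_split /=; apply: eq_bigr => l _.
by rewrite derivM derivC mul0r add0r derivM mulrDr.
Qed.

Definition linepoly x z (i : 'I_D) : {poly R} := (x 0 i)%:P + (z 0 i)%:P * 'X.

Lemma linepoly_horner x z i t : (linepoly x z i).[t] = (x + t *: z) 0 i.
Proof. by rewrite /linepoly !hornerE !mxE mulrC. Qed.

Lemma linepoly_deriv x z i : (linepoly x z i)^`() = (z 0 i)%:P.
Proof. by rewrite derivD derivC add0r derivM derivC mul0r add0r derivX mulr1. Qed.

Definition linetens x z : polytens := fun k => \prod_(j < n) linepoly x z (k j).

Lemma linetens_eval x z t : evalt (linetens x z) t = tpow n (x + t *: z).
Proof.
apply/ffunP => k; rewrite !ffunE horner_prod.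
by apply: eq_bigr => j _; rewrite linepoly_horner.
Qed.

Lemma linetens_deriv x z t :
  evalt (dert (linetens x z)) t = dtpow n (x + t *: z) z.
Proof.
apply/ffunP => k; rewrite ffunE /dert deriv_prod sum_ffunE horner_sum.
apply: eq_bigr => j _; rewrite hornerM linepoly_deriv hornerC horner_prod ffunE.
rewrite [RHS](bigD1 j) //= /put1 eqxx; congr (_ * _).
by apply: eq_bigr => l /negbTE ->; rewrite linepoly_horner.
Qed.

Lemma linetens_deriv2 x z t :
  evalt (dert (dert (linetens x z))) t = d2tpow n (x + t *: z) z.
Proof.
apply/ffunP => k; rewrite ffunE /dert deriv_prod sum_ffunE raddf_sum horner_sum.
apply: eq_bigr => j _ /=; rewrite linepoly_deriv derivM derivC mul0r add0r.
rewrite deriv_prod sum_ffunE hornerM hornerC horner_sum mulr_sumr.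
apply: eq_bigr => l lj; rewrite linepoly_deriv hornerM hornerC horner_prod ffunE.
rewrite [RHS](bigD1 j) //= /put2 eqxx; congr (_ * _).
rewrite [RHS](bigD1 l) //= eqxx orbT; congr (_ * _).
by apply: eq_bigr => i /andP[/negbTE -> /negbTE ->]; rewrite linepoly_horner.
Qed.

(** The derivative in a fixed direction [w] while the base point moves along [z]: the gradient field
    itself has to be differentiated for the Hessian. *)
Definition dirtens x z w : polytens :=
  fun k => \sum_(j < n) \prod_(l < n)
    if l == j then (w 0 (k l))%:P else linepoly x z (k l).

Lemma dirtens_eval x z w t : evalt (dirtens x z w) t = dtpow n (x + t *: z) w.
Proof.
apply/ffunP => k; rewrite ffunE sum_ffunE horner_sum; apply: eq_bigr => j _.
rewrite horner_prod ffunE; apply: eq_bigr => l _; rewrite /put1.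
by case: ifP => _; rewrite ?hornerC ?linepoly_horner.
Qed.

Definition objpoly x z := qform (linetens x z) (linetens x z).

Lemma FobjE x : Fobj B x = frob (Pt x) (tpow n x).
Proof. by rewrite /Fobj frob_norm_sqr frob_oproj. Qed.

Lemma objpoly_horner x z t : (objpoly x z).[t] = Fobj B (x + t *: z).
Proof. by rewrite qform_horner linetens_eval FobjE. Qed.

Lemma qformC p q t : (qform p q).[t] = (qform q p).[t].
Proof. by rewrite !qform_horner oproj_sym frobC. Qed.

Lemma objpoly_deriv x z t : (objpoly x z)^`().[t]
  = 2 * frob (Pt (x + t *: z)) (dtpow n (x + t *: z) z).
Proof.
rewrite qform_deriv hornerD qformC -mulr2n -[LHS]mulr_natl; congr (_ * _).
by rewrite qform_horner linetens_eval linetens_deriv.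
Qed.

Lemma objpoly_deriv2 x z : (objpoly x z)^`()^`().[0]
  = 2 * frob (oproj B (dtpow n x z)) (dtpow n x z)
    + 2 * frob (Pt x) (d2tpow n x z).
Proof.
rewrite qform_deriv derivD !qform_deriv !hornerD.
rewrite (qformC (dert (dert _))) !qform_horner linetens_eval linetens_deriv.
by rewrite linetens_deriv2 scale0r addr0; lra.
Qed.

Lemma egradE x i :
  egrad (Fobj B) x 0 i = 2 * frob (Pt x) (dtpow n x (delta_mx 0 i)).
Proof.
rewrite mxE (_ : 'D_(delta_mx 0 i) (Fobj B) x
               = (objpoly x (delta_mx 0 i))^`().[0]); last first.
  by apply: derive_val; apply: is_derive_line => t; rewrite objpoly_horner.
by rewrite objpoly_deriv scale0r addr0.
Qed.

Lemma dtpow_sum x (I : finType) (c : I -> R) (F : I -> 'rV[R]_D) :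
  dtpow n x (\sum_i c i *: F i) = \sum_i c i *: dtpow n x (F i).
Proof.
have d0 : dtpow n x 0 = 0.
  by have := dtpow_lin n x 1 0 0; rewrite !scale1r addr0 => /eqP;
     rewrite -subr_eq0 opprD addrA subrr sub0r oppr_eq0 => /eqP.
by elim/big_rec2: _ => [//|i u v _ <-]; rewrite dtpow_lin.
Qed.

Lemma dotp_egrad x z : dotp z (egrad (Fobj B) x) = 2 * frob (Pt x) (dtpow n x z).
Proof.
rewrite {2}[z]row_sum_delta dtpow_sum frob_sumr mulr_sumr.
by apply: eq_bigr => i _; rewrite egradE frobZr mulrCA.
Qed.

(** The last term is Euler's identity for a form of degree [2 * n]. The formula holds off the sphere
    as well, so that it may be differentiated along a line. *)
Lemma dotp_rgrad x z : dotp z (rgrad (Fobj B) x)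
  = 2 * frob (Pt x) (dtpow n x z) - 2 * n%:R * Fobj B x * dotp z x.
Proof.
rewrite /rgrad /tanproj dotpBr dotpZr !dotp_egrad dtpow_self frobZr -FobjE.
ring.
Qed.

Definition rgradpoly x z i : {poly R} :=
  2%:P * qform (linetens x z) (dirtens x z (delta_mx 0 i))
  - (2 * n%:R)%:P * objpoly x z * linepoly x z i.

Lemma dotp_delta i y : dotp (delta_mx 0 i) y = y 0 i.
Proof.
rewrite /dotp (bigD1 i) //= big1 ?addr0 => [|j ji]; rewrite mxE eqxx /=.
  by rewrite eqxx mul1r.
by rewrite (negbTE ji) mul0r.
Qed.

Lemma rgradpoly_horner x z i t :
  (rgradpoly x z i).[t] = rgrad (Fobj B) (x + t *: z) 0 i.
Proof.
rewrite -dotp_delta dotp_rgrad dotp_delta /rgradpoly hornerD hornerN !hornerM.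
by rewrite !hornerC objpoly_horner linepoly_horner qform_horner linetens_eval
  dirtens_eval.
Qed.

Lemma derive_rgrad x z :
  'D_z (rgrad (Fobj B)) x = \row_i (rgradpoly x z i)^`().[0].
Proof.
have h i : is_derive x z (fun y => rgrad (Fobj B) y 0 i) (rgradpoly x z i)^`().[0].
  by apply: is_derive_line => t; rewrite rgradpoly_horner.
rewrite derive_mx; last first.
  by apply/derivable_mxP => i j; rewrite ord1; exact: ex_derive.
by apply/rowP => i; rewrite !mxE; apply: derive_val.
Qed.

Lemma dotp_rhess x z : dotp z x = 0 ->
  dotp z (rhess (Fobj B) x z)
  = 2 * frob (oproj B (dtpow n x z)) (dtpow n x z)
    + 2 * frob (Pt x) (d2tpow n x z) - 2 * n%:R * Fobj B x * dotp z z.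
Proof.
move=> zx; rewrite /rhess /tanproj dotpBr dotpZr zx mulr0 subr0 derive_rgrad.
(* [q] is the function [t |-> dotp z (rgrad (Fobj B) (x + t *: z))]: since [z] is orthogonal to [x],
   [dotp z (x + t *: z)] is [t * dotp z z], whence the factor ['X]. *)
pose q := (objpoly x z)^`() - (2 * n%:R * dotp z z)%:P * ('X * objpoly x z).
transitivity (q^`().[0]).
  transitivity ((\sum_i (z 0 i)%:P * rgradpoly x z i)^`().[0]).
    rewrite raddf_sum horner_sum; apply: eq_bigr => i _ /=.
    by rewrite derivM derivC mul0r add0r hornerM hornerC mxE.
  apply: eq_horner_deriv => t.
  transitivity (dotp z (rgrad (Fobj B) (x + t *: z))).
    rewrite horner_sum; apply: eq_bigr => i _.
    by rewrite hornerM hornerC rgradpoly_horner.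
  rewrite dotp_rgrad /q hornerD hornerN !hornerM hornerC hornerX objpoly_deriv.
  by rewrite objpoly_horner dotpDr zx add0r dotpZr; ring.
rewrite /q derivB hornerD hornerN objpoly_deriv2 derivM derivC mul0r add0r.
rewrite derivM derivX mul1r hornerM hornerD hornerM hornerX mul0r addr0 hornerC.
by rewrite objpoly_horner scale0r addr0; ring.
Qed.

(** The working form of criticality. The gradient equation may be tested against every direction,
    tangent or not, because the radial component is accounted for by Euler's identity. *)
Lemma second_order_criticalE x : second_order_critical (Fobj B) x <->
  [/\ sphere x,
      forall z, frob (Pt x) (dtpow n x z) = n%:R * Fobj B x * dotp z x
    & forall z, dotp z x = 0 ->
        frob (oproj B (dtpow n x z)) (dtpow n x z) + frob (Pt x) (d2tpow n x z)
        <= n%:R * Fobj B x * dotp z z].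
Proof.
split=> [[hx g h]|[hx g h]]; split=> //.
- by move=> z; have := dotp_rgrad x z; rewrite g dotpC dotp0l; lra.
- by move=> z zx; have := h z zx; rewrite dotp_rhess //; lra.
- by apply: dotp_eq0; rewrite dotp_rgrad g; lra.
- by move=> z zx; have := h z zx; rewrite dotp_rhess //; lra.
Qed.

End Calculus.

(** * Local maxima on the sphere *)

Section LocalMaxima.
Variable R : realType.

Lemma poly_nonpos_near (r : {poly R}) (e : R) : 0 < e ->
  (forall t, 0 < t < e -> r.[t] <= 0) -> r.[0] <= 0.
Proof.
move=> e0 h; rewrite leNgt; apply/negP => r0.
have /nbhs_ballP [d /= d0 hd] : \forall t \near (0 : R), 0 < r.[t].
  exact: (cvgr_gt r.[0] (@continuous_horner R r 0) 0 r0).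
pose t := Num.min e d / 2.
have m0 : 0 < Num.min e d by rewrite lt_min e0.
have t0 : 0 < t by rewrite divr_gt0.
have tm : t < Num.min e d by rewrite /t; lra.
have te : t < e by rewrite (lt_le_trans tm) // ge_min lexx.
have td : t < d by rewrite (lt_le_trans tm) // ge_min lexx orbT.
have : 0 < r.[t] by apply: hd; rewrite /ball /= sub0r normrN gtr0_norm.
by rewrite ltNge h // t0 te.
Qed.

(** Writing [p = r * 'X], the sign of [p] makes [r] nonpositive to the right of 0 and nonnegative to
    the left, so [r] vanishes at 0; then [p = s * 'X^2] with [s.[0] <= 0]. *)
Lemma poly_max_at0 (p : {poly R}) :
    p.[0] = 0 -> (\forall t \near 0, p.[t] <= 0) ->
  p^`().[0] = 0 /\ p^`()^`().[0] <= 0.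
Proof.
move=> p0 /nbhs_ballP [e /= e0 he].
have hp t : `|t| < e -> p.[t] <= 0.
  by move=> te; apply: he; rewrite /ball /= sub0r normrN.
have [r Ep] : exists r, p = r * 'X.
  have /factor_theorem [r ->] : root p 0 by rewrite /root p0.
  by exists r; rewrite subr0.
have d1 : p^`().[0] = r.[0].
  by rewrite Ep derivM derivX mulr1 hornerD hornerM hornerX mulr0 add0r.
have r_le : r.[0] <= 0.
  apply: (poly_nonpos_near e0) => t /andP[t0 te].
  have := hp t; rewrite gtr0_norm // => /(_ te).
  by rewrite Ep hornerM hornerX pmulr_lle0.
have r_ge : 0 <= r.[0].
  rewrite -oppr_le0.
  have Er t : - r.[- t] = (- (r \Po - 'X)).[t].
    by rewrite hornerN horner_comp hornerN hornerX.
  rewrite -{1}oppr0 Er; apply: (poly_nonpos_near e0) => t /andP[t0 te].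
  have := hp (- t); rewrite normrN gtr0_norm // => /(_ te).
  by rewrite -Er Ep hornerM hornerX mulrN -mulNr pmulr_lle0.
have r0 : r.[0] = 0 by apply/eqP; rewrite eq_le r_le.
rewrite d1 r0; split=> //.
have [s Er] : exists s, r = s * 'X.
  have /factor_theorem [s ->] : root r 0 by rewrite /root r0.
  by exists s; rewrite subr0.
have -> : p^`()^`().[0] = 2 * s.[0].
  rewrite Ep Er !(derivM, derivD, derivX, mulr1) !(hornerD, hornerM, hornerX).
  by rewrite !mulr0 !add0r; ring.
rewrite pmulr_rle0 //; apply: (poly_nonpos_near e0) => t /andP[t0 te].
have := hp t; rewrite gtr0_norm // => /(_ te).
by rewrite Ep Er !hornerM hornerX -mulrA pmulr_lle0 // mulr_gt0.
Qed.

Lemma continuous_mulfun (T : topologicalType) (f g : T -> R) :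
  continuous f -> continuous g -> continuous (f \* g).
Proof. by move=> cf cg y; apply: cvgM; [exact: cf | exact: cg]. Qed.

Lemma continuous_bigsum (T : topologicalType) (I : Type) (s : seq I) (f : I -> T -> R) :
  (forall i, continuous (f i)) -> continuous (fun y => \sum_(i <- s) f i y).
Proof.
move=> cf; elim: s => [|i s IH].
  have -> : (fun y => \sum_(i <- [::]) f i y) = cst 0.
    by apply/funext => y; rewrite big_nil.
  exact: cst_continuous.
have -> : (fun y => \sum_(j <- i :: s) f j y) = f i \+ (fun y => \sum_(j <- s) f j y).
  by apply/funext => y; rewrite big_cons.
by move=> y; apply: cvgD; [exact: cf | exact: IH].
Qed.

Lemma continuous_bigprod (T : topologicalType) (I : Type) (s : seq I) (f : I -> T -> R) :
  (forall i, continuous (f i)) -> continuous (fun y => \prod_(i <- s) f i y).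
Proof.
move=> cf; elim: s => [|i s IH].
  have -> : (fun y => \prod_(i <- [::]) f i y) = cst 1.
    by apply/funext => y; rewrite big_nil.
  exact: cst_continuous.
have -> : (fun y => \prod_(j <- i :: s) f j y) = f i \* (fun y => \prod_(j <- s) f j y).
  by apply/funext => y; rewrite big_cons.
by move=> y; apply: cvgM; [exact: cf | exact: IH].
Qed.

Variables (D n : nat) (B : {vspace tensor R D n}).
Implicit Types x y z : 'rV[R]_D.

Lemma Fobj_scale c x : Fobj B (c *: x) = c ^+ n ^+ 2 * Fobj B x.
Proof. by rewrite !FobjE tpowZ oprojZ frobZl frobZr; ring. Qed.

Lemma normalize_sphere x : 0 < dotp x x -> sphere ((enorm x)^-1 *: x).
Proof.
move=> x0; apply/sphereE; rewrite dotpZl dotpZr mulrA -expr2 exprVn enorm_sqr.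
by rewrite mulVf // gt_eqF.
Qed.

(** The curve is the normalized line [x + t *: z] with [z] tangent. Homogeneity of degree [2 * n]
    clears the square root: the comparison becomes [F(x + t z) <= F(x) q(t)^n] with [q] the squared
    norm of [x + t z], an inequality between polynomials to which [poly_max_at0] applies. *)
Lemma local_max_critical x : sphere x ->
    (\forall y \near x, sphere y -> Fobj B y <= Fobj B x) ->
  second_order_critical (Fobj B) x.
Proof.
move=> hx hmax; have x1 : dotp x x = 1 by apply/sphereE.
have key z : dotp z x = 0 -> frob (oproj B (tpow n x)) (dtpow n x z) = 0 /\
    frob (oproj B (dtpow n x z)) (dtpow n x z)
    + frob (oproj B (tpow n x)) (d2tpow n x z) <= n%:R * Fobj B x * dotp z z.
  move=> zx; pose q : {poly R} := 1%:P + (dotp z z)%:P * 'X^2.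
  have qE0 t : q.[t] = 1 + dotp z z * t ^+ 2.
    by rewrite hornerD hornerM !hornerC hornerXn.
  have qE t : q.[t] = dotp (x + t *: z) (x + t *: z).
    by rewrite qE0 !dotpE x1 (dotpC x z) zx; ring.
  have q_gt0 t : 0 < q.[t].
    by rewrite qE0 ltr_pwDl // mulr_ge0 ?dotp_ge0 ?sqr_ge0.
  pose h := objpoly B x z - (Fobj B x)%:P * q ^+ n.
  have h0 : h.[0] = 0.
    rewrite /h hornerD hornerN hornerM hornerC objpoly_horner horner_exp qE.
    by rewrite scale0r addr0 x1 expr1n mulr1 subrr.
  have hle : \forall t \near 0, h.[t] <= 0.
    have cv : (fun t : R => (Num.sqrt q.[t])^-1 *: (x + t *: z)) @ 0 --> x.
      have c1 : (fun t : R => (Num.sqrt q.[t])^-1) @ 0 --> (1 : R).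
        rewrite -[X in _ --> X]invr1; apply: cvgV; first exact: oner_neq0.
        have q0 : Num.sqrt q.[0] = 1 by rewrite qE scale0r addr0 x1 sqrtr1.
        rewrite -[X in _ --> X]q0.
        apply: (@continuous_comp _ _ _ (horner q) Num.sqrt).
          exact: continuous_horner.
        exact: sqrt_continuous.
      have c2 : (fun t : R => x + t *: z) @ 0 --> x + 0 *: z.
        by apply: cvgD; [exact: cvg_cst | apply: cvgZr_tmp; exact: cvg_id].
      rewrite scale0r addr0 in c2; rewrite -[X in _ --> X]scale1r.
      exact: cvgZ c1 c2.
    have hm : \forall t \near (0 : R), let y := (Num.sqrt q.[t])^-1 *: (x + t *: z) in
        sphere y -> Fobj B y <= Fobj B x by exact: cv _ hmax.
    apply: filterS hm => t /=; rewrite {1 2}qE -/(enorm _) => ht.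
    have := ht (normalize_sphere _); rewrite -qE => /(_ (q_gt0 t)).
    rewrite Fobj_scale /h hornerD hornerN hornerM hornerC objpoly_horner.
    rewrite horner_exp -exprM mulnC exprM exprVn enorm_sqr -qE subr_le0 exprVn.
    by rewrite mulrC ler_pdivrMr // exprn_gt0.
  have [h1 h2] := poly_max_at0 h0 hle.
  have dq : q^`() = (2 * dotp z z)%:P * 'X.
    rewrite /q derivD !derivC add0r derivM derivC mul0r add0r.
    by rewrite derivXn /= expr1 polyCM; ring.
  have q0 : q.[0] = 1 by rewrite qE scale0r addr0.
  have q'0 : q^`().[0] = 0 by rewrite dq hornerM hornerX mulr0.
  have q''0 : q^`()^`().[0] = 2 * dotp z z.
    by rewrite dq derivM derivC mul0r add0r derivX mulr1 hornerC.
  have hd : h^`() = (objpoly B x z)^`() - (Fobj B x)%:P * (q^`() * q ^+ n.-1 *+ n).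
    by rewrite /h derivB derivM derivC mul0r add0r deriv_exp.
  split.
    move: h1; rewrite hd hornerD hornerN hornerM hornerMn hornerM q'0 mul0r mul0rn.
    by rewrite mulr0 subr0 objpoly_deriv scale0r addr0; lra.
  move: h2; rewrite hd derivB hornerD hornerN objpoly_deriv2 derivM derivC mul0r.
  rewrite add0r derivMn derivM hornerM hornerC hornerMn hornerD 2!hornerM q'0 q''0.
  by rewrite mul0r addr0 horner_exp q0 expr1n mulr1 -mulr_natl; lra.
apply/second_order_criticalE; split=> //; last by move=> z /key [].
(* The gradient equation for all [z]: the radial part is given by [dtpow_self], the tangential part
   by [key]. *)
move=> z; have z'x : dotp (z - dotp z x *: x) x = 0.
  by rewrite dotpBl dotpZl x1 mulr1 subrr.
have [g _] := key _ z'x.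
have {1}-> : z = dotp z x *: x + (z - dotp z x *: x) by rewrite addrC subrK.
by rewrite dtpow_lin dtpow_self frobDr !frobZr g FobjE addr0; ring.
Qed.

Lemma continuous_Fobj : continuous (Fobj B).
Proof.
have -> : Fobj B = fun x => \sum_k \sum_l projmx B k l *
    ((\prod_(j < n) x 0 (k j)) * (\prod_(j < n) x 0 (l j))).
  apply/funext => x; rewrite FobjE frob_oproj_sum; apply: eq_bigr => k _.
  by apply: eq_bigr => l _; rewrite !prodtensE.
apply: continuous_bigsum => k; apply: continuous_bigsum => l.
have cp (m : {ffun 'I_n -> 'I_D}) : continuous (fun y : 'rV[R]_D => \prod_(j < n) y 0 (m j)).
  by apply: continuous_bigprod => j y; exact: coord_continuous.
apply: (continuous_mulfun (f := cst (projmx B k l))); first exact: cst_continuous.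
exact: (continuous_mulfun (cp k) (cp l)).
Qed.

End LocalMaxima.

(** * Perturbed projections and nearly orthonormal frames *)

Section Perturbation.
Variables (R : realType) (D n : nat) (A B : {vspace tensor R D n}).
Implicit Types S T : tensor R D n.

Local Notation d := (opnorm (fun T => oproj A T - oproj B T)).

(** A [sup] bounds its set only if that set is bounded; two contractions give the bound 2. *)
Lemma opnorm_oprojB_has_sup :
  has_sup [set frob_norm (oproj A T - oproj B T) | T in [set T | frob_norm T <= 1]].
Proof.
split.
  by exists (frob_norm (oproj A 0 - oproj B 0)); exists 0;
     rewrite //= /frob_norm frob0l sqrtr0.
exists 2 => _ [T /= T1 <-].
apply: (le_trans (frob_norm_triangle _ _)).
rewrite -scaleN1r frob_normZ normrN1 mul1r.
by have := oproj_norm_le A T; have := oproj_norm_le B T; lra.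
Qed.

Lemma opnorm_oprojB_ub T : frob_norm T <= 1 -> frob_norm (oproj A T - oproj B T) <= d.
Proof.
move=> T1; apply: ub_le_sup; last by exists T.
by have [] := opnorm_oprojB_has_sup.
Qed.

Lemma opnorm_oprojB_ge0 : 0 <= d.
Proof.
apply: (le_trans (frob_norm_ge0 (oproj A 0 - oproj B 0))).
by apply: opnorm_oprojB_ub; rewrite /frob_norm frob0l sqrtr0.
Qed.

Lemma oprojB_norm_le T : frob_norm (oproj A T - oproj B T) <= d * frob_norm T.
Proof.
have [T0|T0] := eqVneq (frob_norm T) 0.
  have -> : T = 0 *: T.
    by rewrite scale0r; apply: frob_eq0; rewrite -frob_norm_sqr T0 expr0n.
  by rewrite !oprojZ -scalerBr !frob_normZ normr0 !mul0r mulr0.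
have T_gt0 : 0 < frob_norm T by rewrite lt_def T0 frob_norm_ge0.
have := @opnorm_oprojB_ub ((frob_norm T)^-1 *: T).
rewrite frob_normZ ger0_norm ?invr_ge0 ?frob_norm_ge0 // mulVf // => /(_ (lexx _)).
rewrite !oprojZ -scalerBr frob_normZ ger0_norm ?invr_ge0 ?frob_norm_ge0 //.
by rewrite mulrC ler_pdivrMr.
Qed.

Lemma frob_oprojB_le S T :
  `|frob (oproj A S) T - frob (oproj B S) T| <= d * (frob_norm S * frob_norm T).
Proof.
rewrite -frobBl mulrA; apply: (le_trans (frob_abs_le _ _)).
by apply: ler_wpM2r; [exact: frob_norm_ge0 | exact: oprojB_norm_le].
Qed.

End Perturbation.

(** * Gram systems of a nearly orthonormal frame *)

Section Frames.
Variables (R : realType) (D K : nat) (a : 'I_K -> 'rV[R]_D).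
Hypothesis ha : forall i, sphere (a i).
Implicit Types (x y : 'rV[R]_D) (s : nat) (i j k : 'I_K).

Lemma rho_ub s x : sphere x -> \sum_(i < K) `|dotp x (a i)| ^+ s <= 1 + rho a s.
Proof.
move=> hx; rewrite /rho addrCA subrr addr0; apply: ub_le_sup; last by exists x.
exists K%:R => _ [y hy <-].
rewrite -[X in _ <= X%:R]card_ord -sumr_const; apply: ler_sum => i _.
by rewrite exprn_ile1 // dotp_sphere_le1.
Qed.

(** At the point [a k] the diagonal summand is exactly the 1 that is subtracted in [rho]. *)
Lemma rho_offdiag s k : \sum_(j | j != k) `|dotp (a j) (a k)| ^+ s <= rho a s.
Proof.
have := rho_ub s (ha k); rewrite (bigD1 k) //= (sphereE _).1 // normr1 expr1n.
rewrite lerD2l => h; apply: le_trans h; apply: ler_sum => j _.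
by rewrite dotpC.
Qed.

Lemma rho_ge0 s k : 0 <= rho a s.
Proof. by apply: le_trans (rho_offdiag s k); apply: sumr_ge0 => j _; rewrite exprn_ge0. Qed.

(** The upper frame bound, extended by homogeneity because it is applied to rejections and
    differences of points, which are not unit vectors. *)
Lemma frame_upper x : \sum_(i < K) dotp x (a i) ^+ 2 <= (1 + rho a 2) * dotp x x.
Proof.
have [x0|x0] := eqVneq (dotp x x) 0.
  rewrite (dotp_eq0 x0) !dotp0l mulr0 big1 // => i _.
  by rewrite dotp0l expr0n.
have x_gt0 : 0 < dotp x x by rewrite lt_def x0 dotp_ge0.
have := rho_ub 2 (normalize_sphere x_gt0).
under eq_bigr do rewrite real_normK ?num_real // dotpZl exprMn exprVn enorm_sqr.
by rewrite -mulr_sumr mulrC ler_pdivrMr.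
Qed.

(** Diagonal dominance: where [|c|] is largest, the equation gives [|c| <= Q + rho a s * |c|]; in
    every other equation the off-diagonal part is then at most [rho a s] times this maximum. *)
Lemma gram_inverse_sup s (c h : 'I_K -> R) Q : rho a s < 1 ->
    (forall k, \sum_j c j * dotp (a j) (a k) ^+ s = h k) ->
    (forall k, `|h k| <= Q) ->
  forall k, `|c k| <= Q / (1 - rho a s) /\
            `|c k - h k| <= rho a s * (Q / (1 - rho a s)).
Proof.
move=> r1 hc hQ k0; have r0 := rho_ge0 s k0.
have [k _ kmax] := arg_maxP (fun k => `|c k|) (erefl (xpredT k0)).
set W := Q / _.
have E j : `|c j - h j| <= `|c k| * rho a s.
  have -> : c j - h j = - \sum_(l | l != j) c l * dotp (a l) (a j) ^+ s.
    rewrite -hc (bigD1 j) //= (sphereE _).1 // expr1n mulr1; ring.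
  rewrite normrN; apply: (le_trans (ler_norm_sum _ _ _)).
  apply: (@le_trans _ _ (\sum_(l | l != j) `|c k| * `|dotp (a l) (a j)| ^+ s)).
    apply: ler_sum => l _; rewrite normrM normrX; apply: ler_wpM2r.
      by rewrite exprn_ge0.
    exact: kmax.
  by rewrite -mulr_sumr ler_wpM2l // rho_offdiag.
have cW : `|c k| <= W.
  rewrite /W ler_pdivlMr ?subr_gt0 //.
  have := E k; have := hQ k; have := ler_normD (c k - h k) (h k).
  by rewrite subrK; lra.
split; first exact: le_trans (kmax k0 isT) cW.
by apply: (le_trans (E k0)); rewrite mulrC ler_wpM2l.
Qed.

Lemma spanA_mem n i : tpow n (a i) \in spanA n a.
Proof. by apply: memv_span; apply/mapP; exists i; rewrite ?mem_enum. Qed.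

(** Any coefficients that represent the projection satisfy the normal equations, whose matrix
    consists of the powers of the inner products of the frame. *)
Lemma oproj_spanA n T : exists c : 'I_K -> R,
  oproj (spanA n a) T = \sum_j c j *: tpow n (a j) /\
  forall k, \sum_j c j * dotp (a j) (a k) ^+ n = frob T (tpow n (a k)).
Proof.
pose X := [tuple tpow n (a i) | i < K].
exists (fun j => coord X j (oproj (spanA n a) T)).
have E : oproj (spanA n a) T
    = \sum_j coord X j (oproj (spanA n a) T) *: tpow n (a j).
  rewrite {1}(coord_span (oproj_mem (spanA n a) T)).
  by apply: eq_bigr => j _; rewrite -tnth_nth tnth_mktuple.
split=> // k; rewrite -(oproj_orth _ (spanA_mem n k)) [in RHS]E frob_suml.
by apply: eq_bigr => j _; rewrite frobZl frob_tpow.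
Qed.

End Frames.

(** * Location of the critical points *)

(** The mixed powers in the factorization are dominated by the binomial expansion of
    [(|x| + |y|) ^ p], so no factor [p + 1] appears; this keeps the coefficients in the gradient
    estimate free of a factor [N]. *)
Lemma subrX_norm_le (R : realDomainType) (x y : R) p :
  `|x ^+ p.+1 - y ^+ p.+1| <= `|x - y| * (`|x| + `|y|) ^+ p.
Proof.
elim: p => [|p IH]; first by rewrite !expr1 expr0 mulr1.
have -> : x ^+ p.+2 - y ^+ p.+2
    = x * (x ^+ p.+1 - y ^+ p.+1) + (x - y) * y ^+ p.+1 by rewrite !exprS; ring.
apply: (le_trans (ler_normD _ _)); rewrite !normrM.
set S := `|x| + `|y|; rewrite [S ^+ p.+1]exprS.
have h1 : `|x| * `|x ^+ p.+1 - y ^+ p.+1| <= `|x| * (`|x - y| * S ^+ p).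
  exact: ler_wpM2l.
have h2 : `|x - y| * `|y ^+ p.+1| <= `|x - y| * (`|y| * S ^+ p).
  apply: ler_wpM2l => //; rewrite normrX exprS; apply: ler_wpM2l => //.
  by apply: lerXn2r; rewrite ?nnegrE ?addr_ge0 // lerDr.
apply: (le_trans (lerD h1 h2)); rewrite /S; lra.
Qed.

Lemma sqrX_split (R : comPzRingType) (z : R) k :
  (z ^+ 2) ^+ k.+1 = z ^+ k.+2 * z ^+ k.
Proof. by rewrite -exprM -exprD; congr (_ ^+ _); lia. Qed.

(* The tensor order is written [k.+2], so that [k.+1] and [k] are the exponents
   [n - 1] and [n - 2] of the gradient and of the Hessian. *)
Section Estimates.
Variables (R : realType) (D K k : nat) (a : 'I_K -> 'rV[R]_D).
Variable B : {vspace tensor R D k.+2}.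
Hypothesis ha : forall i, sphere (a i).
Hypothesis tau_ge0 : 0 <= tau k.+2 a.
Implicit Types (x y z : 'rV[R]_D) (i j : 'I_K).

Local Notation N := (k.+2%:R : R).
Local Notation r2 := (rho a 2).
Local Notation rn := (rho a k.+2).
Local Notation c1 := ((1 - rho a k.+2)^-1).
Local Notation A := (spanA k.+2 a).
Local Notation PA x := (oproj A (tpow k.+2 x)).
Local Notation Delta := (DeltaA a B).
Local Notation t := (tau k.+2 a).

Lemma N_ge2 : 2 <= N. Proof. by rewrite ler_nat. Qed.

Lemma natrS_pred : k.+1%:R = N - 1.
Proof. by rewrite -[k.+2]addn1 natrD addrK. Qed.

Lemma budget : N ^+ 2 * r2 + (N ^+ 2 + N) * rn + t = 6^-1.
Proof. by rewrite /tau; lra. Qed.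

(** The index [i] guarantees a nonempty frame: for an empty one every [rho] is -1. The numbers are
    1/6 divided by 4 and by 6, the least values of [N ^+ 2] and [N ^+ 2 + N]. *)
Lemma rho_small i : [/\ 0 <= r2, 0 <= rn, r2 <= 1 / 24, rn <= 1 / 36 & t <= 1 / 6].
Proof.
have r20 := rho_ge0 ha 2 i; have rn0 := rho_ge0 ha k.+2 i.
have b := budget; have N2 := N_ge2; have t0 := tau_ge0.
have N4 : 4 <= N ^+ 2 by nra.
have p1 : 4 * r2 <= N ^+ 2 * r2 by apply: ler_wpM2r.
have p2 : 6 * rn <= (N ^+ 2 + N) * rn by apply: ler_wpM2r => //; lra.
have e6 : 6^-1 = 1 / 6 :> R by rewrite div1r.
by split=> //; lra.
Qed.

Lemma c1_bounds i : 1 <= c1 <= 36 / 35.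
Proof.
have [_ rn0 _ rn1 _] := rho_small i.
have p : 0 < 1 - rn by lra.
apply/andP; split; first by rewrite -[1]invr1 lef_pV2 ?posrE; lra.
by rewrite -[36 / 35]invrK lef_pV2 ?posrE ?invf_div; lra.
Qed.

Lemma c1E i : rn * c1 = c1 - 1.
Proof.
have [_ rn0 _ rn1 _] := rho_small i.
by field; apply/negP => /eqP h; lra.
Qed.

Lemma Delta_ge0 : 0 <= Delta. Proof. exact: opnorm_oprojB_ge0. Qed.

Lemma frob_proj_close S T :
  `|frob (oproj A S) T - frob (oproj B S) T| <= Delta * (frob_norm S * frob_norm T).
Proof. exact: frob_oprojB_le. Qed.

Lemma frob_norm_tpow x : sphere x -> frob_norm (tpow k.+2 x) = 1.
Proof. by move=> /sphereE h; rewrite /frob_norm frob_tpow h expr1n sqrtr1. Qed.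

Lemma Fobj_close x : sphere x -> `|Fobj A x - Fobj B x| <= Delta.
Proof.
move=> hx; have := frob_proj_close (tpow k.+2 x) (tpow k.+2 x).
by rewrite frob_norm_tpow // !mulr1 -!FobjE.
Qed.

Lemma Fobj_le1 x : sphere x -> Fobj A x <= 1.
Proof.
move=> hx; rewrite /Fobj -[1](expr1n _ 2).
apply: lerXn2r; rewrite ?nnegrE ?frob_norm_ge0 //.
by rewrite -(frob_norm_tpow hx); exact: oproj_norm_le.
Qed.

Lemma coef_bound x m : (forall j, `|dotp x (a j)| <= m) ->
  exists s : 'I_K -> R, PA x = \sum_j s j *: tpow k.+2 (a j) /\
    forall j, `|s j| <= m ^+ k.+2 * c1 /\
      `|s j - dotp x (a j) ^+ k.+2| <= rn * (m ^+ k.+2 * c1).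
Proof.
move=> hm; have [s [Es hs]] := oproj_spanA a (tpow k.+2 x).
exists s; split=> // j.
have [r20 rn0 r21 rn1 _] := rho_small j.
apply: (@gram_inverse_sup R D K a ha k.+2 s (fun l => dotp x (a l) ^+ k.+2)) => [|l|l].
- by lra.
- by rewrite hs frob_tpow.
by rewrite normrX lerXn2r ?nnegrE // (le_trans _ (hm l)).
Qed.

Lemma frob_PA_sum x (s : 'I_K -> R) T : PA x = \sum_j s j *: tpow k.+2 (a j) ->
  frob (PA x) T = \sum_j s j * frob T (tpow k.+2 (a j)).
Proof.
by move=> ->; rewrite frob_suml; apply: eq_bigr => j _; rewrite frobZl frobC.
Qed.

(** In the expansion of the value, each coefficient is at most [m ^+ n * c1] and [n - 2] of the [n]
    factors [dotp x (a j)] are at most [m]; the two remaining factors are summed by the frame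
    bound. *)
Lemma Fobj_upper x i : sphere x ->
    (forall j, `|dotp x (a j)| <= `|dotp x (a i)|) ->
  Fobj A x <= (dotp x (a i) ^+ 2) ^+ k.+1 * ((1 + r2) * c1).
Proof.
move=> hx hm; set m : R := `|dotp x (a i)| in hm.
have m0 : 0 <= m by exact: normr_ge0.
have [s [Es hs]] := coef_bound hm.
have [r20 rn0 r21 rn1 _] := rho_small i.
have /andP[c11 _] := c1_bounds i; have c10 : 0 <= c1 by lra.
rewrite FobjE (frob_PA_sum _ Es).
apply: (@le_trans _ _ (\sum_j m ^+ k.+2 * c1 * m ^+ k * dotp x (a j) ^+ 2)).
  apply: ler_sum => j _; rewrite frob_tpow.
  apply: (le_trans (ler_norm _)); rewrite normrM normrX -mulrA.
  apply: ler_pM => //; first by case: (hs j).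
  rewrite -addn2 exprD real_normK ?num_real //; apply: ler_wpM2r.
    exact: sqr_ge0.
  by rewrite lerXn2r ?nnegrE.
rewrite -mulr_sumr.
have -> : (dotp x (a i) ^+ 2) ^+ k.+1 * ((1 + r2) * c1)
    = m ^+ k.+2 * c1 * m ^+ k * (1 + r2).
  rewrite -(real_normK (num_real (dotp x (a i)))) -/m.
  by rewrite sqrX_split; ring.
apply: ler_wpM2l; first by do ![exact: exprn_ge0 | exact: c10 | apply: mulr_ge0].
by have := frame_upper ha x; rewrite (sphereE _).1 // mulr1.
Qed.

Definition rejection x i := a i - dotp x (a i) *: x.

Lemma rejection_facts x i : sphere x ->
  [/\ dotp (rejection x i) x = 0,
      dotp (rejection x i) (rejection x i) = 1 - dotp x (a i) ^+ 2
    & dotp (rejection x i) (a i) = 1 - dotp x (a i) ^+ 2].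
Proof.
move=> /sphereE x1; have /sphereE a1 := ha i.
by split; rewrite /rejection !dotpE ?x1 ?a1 ?(dotpC (a i) x); ring.
Qed.

(** With [M] and [d] as in the proof, Bessel gives [N ^+ 2 * M * d ^+ 2] for the first-derivative
    term, and the summand of index [i] gives [N * (N - 1) * M * d ^+ 2] for the second-derivative
    term. Their sum divided by [N * d] is the left side. The noise adds up to
    [N * d + N * (N - 1) * d = N ^+ 2 * d] times [Delta]. *)
Lemma hessian_at_rejection x i : second_order_critical (Fobj B) x ->
    (forall j, `|dotp x (a j)| <= `|dotp x (a i)|) ->
    0 < 1 - dotp x (a i) ^+ 2 ->
  (2 * N - 1) * ((dotp x (a i) ^+ 2) ^+ k.+1 * (1 - dotp x (a i) ^+ 2))
  <= (N - 1) * (rn * c1 * (1 + r2)) * (dotp x (a i) ^+ 2) ^+ k.+1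
     + N * Delta + Fobj B x.
Proof.
move=> /second_order_criticalE [hx _ hess] hm d0.
have [ux uu ua] := rejection_facts i hx.
set u := rejection x i in ux uu ua; set d := 1 - _ in d0 uu ua *.
set m : R := `|dotp x (a i)| in hm; have m0 : 0 <= m by exact: normr_ge0.
have Em : (dotp x (a i) ^+ 2) ^+ k.+1 = m ^+ k.+2 * m ^+ k.
  rewrite -(real_normK (num_real (dotp x (a i)))) -/m.
  exact: sqrX_split.
set M := (dotp x (a i) ^+ 2) ^+ k.+1 in Em *.
have M0 : 0 <= M by rewrite Em mulr_ge0 ?exprn_ge0.
have [r20 rn0 r21 rn1 _] := rho_small i.
have /andP[c11 _] := c1_bounds i; have c10 : 0 <= c1 by lra.
have [s [Es hs]] := coef_bound hm.
have := hess u ux; rewrite uu => H.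
have N2 := N_ge2.
have e1 := frob_proj_close (dtpow k.+2 x u) (dtpow k.+2 x u).
rewrite -expr2 frob_norm_sqr frob_dtpow_tangent // uu in e1.
have e2 := frob_proj_close (tpow k.+2 x) (d2tpow k.+2 x u).
rewrite frob_norm_tpow // mul1r in e2.
have e2' : Delta * frob_norm (d2tpow k.+2 x u) <= Delta * (N * (N - 1) * d).
  apply: ler_wpM2l; first exact: Delta_ge0.
  have := frob_norm_d2tpow k.+2 u hx; rewrite uu /=.
  by rewrite natrS_pred.
have e3 := frob_oproj_ge (dtpow k.+2 x u) (spanA_mem a k.+2 i).
rewrite frob_tpow (sphereE _).1 // expr1n frob_dtpow ua /= in e3.
have {}e3 := e3 erefl.
have {}e3 : N ^+ 2 * M * d ^+ 2 <= frob (oproj A (dtpow k.+2 x u)) (dtpow k.+2 x u).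
  by apply: le_trans e3; rewrite !exprMn /M -!exprM mulnC mulrA.
(* After replacing each coefficient by [dotp x (a j) ^+ n] all summands are nonnegative, since their
   exponent [2 * (n - 1)] is even, and only the one of index [i] is kept. The replacement costs
   [rn * c1 * M] per summand. *)
have e4 : N * (N - 1) * (M * d ^+ 2 - rn * c1 * M * ((1 + r2) * d))
    <= frob (PA x) (d2tpow k.+2 x u).
  rewrite (frob_PA_sum _ Es).
  under [leRHS]eq_bigr => j _.
    rewrite frob_d2tpow /= natrS_pred.
    rewrite mulrCA; over.
  rewrite -mulr_sumr; apply: ler_wpM2l; first by apply: mulr_ge0; lra.
  have hu : \sum_j dotp u (a j) ^+ 2 <= (1 + r2) * d.
    by have := frame_upper ha u; rewrite uu.
  have : rn * c1 * M * \sum_j dotp u (a j) ^+ 2 <= rn * c1 * M * ((1 + r2) * d).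
    by apply: ler_wpM2l; rewrite ?mulr_ge0.
  have : \sum_j ((dotp x (a j) ^+ 2) ^+ k.+1 * dotp u (a j) ^+ 2
       - rn * c1 * M * dotp u (a j) ^+ 2)
      <= \sum_j s j * (dotp x (a j) ^+ k * dotp u (a j) ^+ 2).
    apply: ler_sum => j _; rewrite -mulrBl mulrA; apply: ler_wpM2r.
      exact: sqr_ge0.
    have [_ hj] := hs j.
    rewrite sqrX_split.
    rewrite lerBlDr -lerBlDl -mulrBl; apply: (le_trans (ler_norm _)).
    rewrite normrM distrC normrX Em.
    have -> : rn * c1 * (m ^+ k.+2 * m ^+ k) = rn * (m ^+ k.+2 * c1) * m ^+ k by ring.
    by apply: ler_pM => //; rewrite lerXn2r ?nnegrE.
  rewrite sumrB -mulr_sumr.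
  have : M * d ^+ 2 <= \sum_j (dotp x (a j) ^+ 2) ^+ k.+1 * dotp u (a j) ^+ 2.
    rewrite (bigD1 i) //= ua lerDl; apply: sumr_ge0 => j _.
    by apply: mulr_ge0; [apply: exprn_ge0|]; exact: sqr_ge0.
  lra.
move: e1 e2; rewrite !ler_norml => /andP[_ e1] /andP[_ e2].
rewrite -subr_ge0 -(pmulr_rge0 _ (_ : 0 < N * d)); last by apply: mulr_gt0; lra.
have {}H : frob (oproj A (dtpow k.+2 x u)) (dtpow k.+2 x u)
    + frob (PA x) (d2tpow k.+2 x u)
    <= N * Fobj B x * d + Delta * (N * d) + Delta * (N * (N - 1) * d) by lra.
have {}H := le_trans (lerD e3 e4) H.
move: H; rewrite -subr_ge0; set Y := N * d; set Z := rn * c1 * (1 + r2).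
by congr (0 <= _); rewrite /Y /Z; ring.
Qed.

End Estimates.

(** * The gradient equation tested against the rejection *)

Lemma ler_norm_sqr (R : realDomainType) (x b : R) :
  0 <= b -> x ^+ 2 <= b ^+ 2 -> `|x| <= b.
Proof.
by move=> b0 h; rewrite -ler_sqr ?nnegrE // real_normK ?num_real.
Qed.

Lemma exprMn_le (R : realDomainType) (x m : R) p :
  0 <= x -> x <= 1 -> 0 <= m -> (x * m) ^+ p.+1 <= x * m ^+ p.+1.
Proof.
move=> x0 x1 m0; rewrite exprMn exprS; apply: ler_wpM2r; first exact: exprn_ge0.
by apply: ler_piMr => //; exact: exprn_ile1.
Qed.

Lemma sqrX_merge (R : comPzRingType) (m : R) k :
  (m ^+ k.+2 * m ^+ k.+1) ^+ 2 = (m ^+ 2) ^+ (2 * k + 3).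
Proof. by rewrite -exprD -!exprM; congr (_ ^+ _); lia. Qed.

Section GradientEstimate.
Variables (R : realType) (D K k : nat) (a : 'I_K -> 'rV[R]_D).
Variable B : {vspace tensor R D k.+2}.
Hypothesis ha : forall i, sphere (a i).
Hypothesis tau_ge0 : 0 <= tau k.+2 a.
Implicit Types (x y z : 'rV[R]_D) (i j : 'I_K).

Local Notation N := (k.+2%:R : R).
Local Notation r2 := (rho a 2).
Local Notation rn := (rho a k.+2).
Local Notation c1 := ((1 - rho a k.+2)^-1).
Local Notation PB x := (oproj B (tpow k.+2 x)).
Local Notation Delta := (DeltaA a B).
Local Notation t := (tau k.+2 a).

Lemma other_dotp_le x i j : sphere x -> j != i ->
  dotp x (a j) ^+ 2 <= 1 - dotp x (a i) ^+ 2 + r2.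
Proof.
move=> hx ji; have := frame_upper ha x; rewrite (sphereE x).1 // mulr1.
rewrite (bigD1 i) //= (bigD1 j) //=.
have : 0 <= \sum_(l < K | (l != i) && (l != j)) dotp x (a l) ^+ 2.
  by apply: sumr_ge0 => l _; exact: sqr_ge0.
lra.
Qed.

Lemma gram_offdiag_le i j : j != i -> dotp (a i) (a j) ^+ 2 <= r2.
Proof.
move=> ji; apply: le_trans (other_dotp_le (ha i) ji) _.
by rewrite (sphereE (a i)).1 // expr1n subrr add0r.
Qed.

(** The parameters bound quantities relative to [m = |dotp x (a i)|]: [Bd] the other correlations,
    [Dd] the root of [d], and [H] the part of the rejection seen by the other frame vectors, per
    root of [d]; [G] bounds the correlations inside the frame. They keep the errors below the
    fraction [1 - e] of the main term, so [N * (W * d * e) <= Delta * C], where [C ^+ 2 = N * d]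
    because the rejection is tangent. Squaring and cancelling [N * d] leaves the exponent
    [2 * n - 1], written [2 * k + 3]. *)
Lemma gradient_at_rejection x i Bd G H Dd e : sphere x ->
    frob (PB x) (dtpow k.+2 x (rejection a x i)) = 0 ->
    0 <= Bd -> 0 <= G -> 0 <= H -> 0 <= Dd -> Bd + G <= 1 ->
    0 < dotp x (a i) ^+ 2 ->
    1 - dotp x (a i) ^+ 2 + r2 <= Bd ^+ 2 * dotp x (a i) ^+ 2 ->
    r2 <= G ^+ 2 ->
    dotp x (a i) ^+ 2 + r2 <= H ^+ 2 * dotp x (a i) ^+ 2 ->
    1 - dotp x (a i) ^+ 2 <= Dd ^+ 2 * dotp x (a i) ^+ 2 ->
    ((Bd + G) * Bd * H + rn * Dd) * c1 <= 1 - e -> 0 <= e ->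
  N * (1 - dotp x (a i) ^+ 2) * (dotp x (a i) ^+ 2) ^+ (2 * k + 3) * e ^+ 2
  <= Delta ^+ 2.
Proof.
move=> hx grad B0 G0 H0 D0 BG mu0 hB hG hH hD he e0.
have x1 := (sphereE x).1 hx.
have [ux uu ua] := rejection_facts ha i hx.
set u := rejection a x i in grad ux uu ua.
have Emu := real_normK (num_real (dotp x (a i))).
set mu := dotp x (a i) ^+ 2 in Emu uu ua mu0 hB hH hD *.
set m : R := `|dotp x (a i)| in Emu.
have m0 : 0 <= m by exact: normr_ge0.
set d := 1 - mu in uu ua hB hD *.
have d0 : 0 <= d by rewrite -uu dotp_ge0.
pose sd := Num.sqrt d.
have sd0 : 0 <= sd by exact: sqrtr_ge0.
have Esd : sd ^+ 2 = d by rewrite sqr_sqrtr.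
have sdD : sd <= Dd * m.
  by rewrite -ler_sqr ?nnegrE ?mulr_ge0 // Esd exprMn Emu.
have [r20 rn0 r21 rn1 _] := rho_small ha tau_ge0 i.
have /andP[c11 _] := c1_bounds ha tau_ge0 i; have c10 : 0 <= c1 by lra.
have N2 := N_ge2 R k.
have Bd1 : Bd <= 1 by lra.
have BG0 : 0 <= Bd + G by lra.
have zB j : j != i -> `|dotp x (a j)| <= Bd * m.
  move=> ji; apply: ler_norm_sqr; first exact: mulr_ge0.
  by rewrite exprMn Emu; apply: le_trans (other_dotp_le hx ji) hB.
have gG j : j != i -> `|dotp x (a i) * dotp (a i) (a j)| <= G * m.
  move=> ji; rewrite normrM -/m mulrC; apply: ler_wpM2r => //.
  by apply: ler_norm_sqr => //; apply: le_trans (gram_offdiag_le ji) hG.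
(* [v] is orthogonal to [a i] and its norm is the root of [d]: each correlation of [x] differs by at
   most this much from that of its projection on the axis. *)
pose v := x - dotp x (a i) *: a i.
have vv : dotp v v = d.
  by rewrite /v !dotpE x1 (sphereE (a i)).1 // (dotpC (a i) x) /d /mu; ring.
have va j : `|dotp x (a j) - dotp x (a i) * dotp (a i) (a j)| <= sd.
  apply: ler_norm_sqr => //; rewrite Esd -vv.
  have := dotp_CS v (a j); rewrite (sphereE (a j)).1 // mulr1; apply: le_trans.
  by rewrite /v dotpBl dotpZl.
have [s0 [Es hs0]] := oproj_spanA a (tpow k.+2 x).
(* Removing the axis component [dotp x (a i) ^+ n *: tpow n (a i)] before solving the Gram system
   leaves right-hand sides [q] that vanish at [i] and carry a root of [d] elsewhere. The inner
   products with the rejection supply the other root, so the errors are proportional to [d], like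
   the main term. *)
pose s j := s0 j - (if j == i then dotp x (a i) ^+ k.+2 else 0).
pose q l := dotp x (a l) ^+ k.+2 - (dotp x (a i) * dotp (a i) (a l)) ^+ k.+2.
pose Q := sd * ((Bd + G) * m) ^+ k.+1.
have Q0 : 0 <= Q by apply: mulr_ge0 => //; apply: exprn_ge0; exact: mulr_ge0.
have hs l : \sum_j s j * dotp (a j) (a l) ^+ k.+2 = q l.
  under eq_bigr do rewrite mulrBl.
  rewrite sumrB hs0 frob_tpow; congr (_ - _).
  rewrite (bigD1 i) //= eqxx big1 ?addr0 ?exprMn // => j /negbTE ->.
  by rewrite mul0r.
have hq l : `|q l| <= Q.
  have [->|li] := eqVneq l i.
    by rewrite /q (sphereE (a i)).1 // mulr1 subrr normr0.
  apply: (le_trans (subrX_norm_le _ _ _)); apply: ler_pM.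
  - exact: normr_ge0.
  - by apply: exprn_ge0; exact: addr_ge0.
  - exact: va.
  apply: lerXn2r; rewrite ?nnegrE ?addr_ge0 ?mulr_ge0 //.
  by rewrite mulrDl; apply: lerD; [exact: zB | exact: gG].
have rn_lt1 : rn < 1 by lra.
have sQ := gram_inverse_sup ha rn_lt1 hs hq.
have siQ : `|s i| <= rn * (Q * c1).
  have [_] := sQ i; rewrite (_ : q i = 0) ?subr0 //.
  by rewrite /q (sphereE (a i)).1 // mulr1 subrr.
have T_le := frob_proj_close a B (tpow k.+2 x) (dtpow k.+2 x u).
rewrite grad subr0 frob_norm_tpow // mul1r (frob_PA_sum _ Es) in T_le.
pose S := \sum_(j | j != i) s j * (dotp x (a j) ^+ k.+1 * dotp u (a j)).
have ET : \sum_j s0 j * frob (dtpow k.+2 x u) (tpow k.+2 (a j))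
    = N * (dotp x (a i) ^+ k.+2 * dotp x (a i) ^+ k.+1 * d
           + s i * (dotp x (a i) ^+ k.+1 * d) + S).
  transitivity (N * \sum_j s0 j * (dotp x (a j) ^+ k.+1 * dotp u (a j))).
    rewrite mulr_sumr; apply: eq_bigr => j _.
    by rewrite frob_dtpow /= mulrCA.
  congr (_ * _); rewrite (bigD1 i) //= ua /s eqxx; congr (_ + _); first by ring.
  by apply: eq_bigr => j /negbTE; rewrite /s => ->; rewrite subr0.
rewrite {}ET normrM ger0_norm ?ler0n // in T_le.
set W := m ^+ k.+2 * m ^+ k.+1.
have W0 : 0 <= W by apply: mulr_ge0; exact: exprn_ge0.
have p_le : ((Bd + G) * m) ^+ k.+1 <= (Bd + G) * m ^+ k.+1 by exact: exprMn_le.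
have R1 : `|s i * (dotp x (a i) ^+ k.+1 * d)| <= rn * c1 * Dd * (W * d).
  rewrite normrM normrM normrX -/m (ger0_norm d0).
  have -> : rn * c1 * Dd * (W * d)
      = rn * (Dd * m * m ^+ k.+1 * c1) * (m ^+ k.+1 * d) by rewrite /W !exprS; ring.
  apply: ler_wpM2r; first by apply: mulr_ge0 => //; exact: exprn_ge0.
  apply: (le_trans siQ); apply: ler_wpM2l => //; apply: ler_wpM2r => //.
  apply: ler_pM => //; first by apply: exprn_ge0; exact: mulr_ge0.
  apply: (le_trans p_le); rewrite -[leRHS]mul1r; apply: ler_wpM2r => //.
  exact: exprn_ge0.
have R2 : `|S| <= c1 * ((Bd + G) * Bd * H) * (W * d).
  apply: (le_trans (ler_norm_sum _ _ _)).
  have hu : \sum_(j | j != i) dotp u (a j) ^+ 2 <= (sd * (H * m)) ^+ 2.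
    rewrite !exprMn Esd Emu; apply: le_trans (_ : d * (mu + r2) <= _); last first.
      exact: ler_wpM2l.
    have := frame_upper ha u; rewrite uu (bigD1 i) //= ua /d; lra.
  have hz : \sum_(j | j != i) dotp x (a j) ^+ 2 <= (Bd * m) ^+ 2.
    rewrite exprMn Emu; apply: le_trans hB.
    have := frame_upper ha x; rewrite x1 (bigD1 i) //= -/mu /d; lra.
  have hzu := sum_norm_le (mulr_ge0 B0 m0) (mulr_ge0 sd0 (mulr_ge0 H0 m0)) hz hu.
  apply: (@le_trans _ _ (Q * c1 * (Bd * m) ^+ k *
      \sum_(j | j != i) `|dotp x (a j)| * `|dotp u (a j)|)).
    rewrite mulr_sumr; apply: ler_sum => j ji; rewrite !normrM normrX exprSr.
    set zj := `|dotp x (a j)|; set uj := `|dotp u (a j)|.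
    have -> : `|s j| * (zj ^+ k * zj * uj) = `|s j| * zj ^+ k * (zj * uj) by ring.
    apply: ler_wpM2r; first by apply: mulr_ge0; exact: normr_ge0.
    apply: ler_pM; [exact: normr_ge0 | exact/exprn_ge0/normr_ge0 | by case: (sQ j) | ].
    by apply: lerXn2r; [exact: normr_ge0 | exact: mulr_ge0 | exact: zB].
  apply: le_trans (_ : Q * c1 * (Bd * m) ^+ k * (Bd * m * (sd * (H * m))) <= _).
    by apply: ler_wpM2l => //; apply: mulr_ge0;
       [exact: mulr_ge0 | apply: exprn_ge0; exact: mulr_ge0].
  have -> : Q * c1 * (Bd * m) ^+ k * (Bd * m * (sd * (H * m)))
      = c1 * (sd * sd) * H * m * (((Bd + G) * m) ^+ k.+1 * (Bd * m) ^+ k.+1).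
    by rewrite /Q [(Bd * m) ^+ k.+1]exprSr; ring.
  have -> : c1 * ((Bd + G) * Bd * H) * (W * d)
      = c1 * (sd * sd) * H * m * (((Bd + G) * m ^+ k.+1) * (Bd * m ^+ k.+1)).
    by rewrite /W -Esd [m ^+ k.+2]exprS; ring.
  apply: ler_wpM2l; first by do ![apply: mulr_ge0 => //].
  apply: ler_pM => //; last exact: exprMn_le.
  - by apply: exprn_ge0; exact: mulr_ge0.
  - by apply: exprn_ge0; exact: mulr_ge0.
set C := frob_norm (dtpow k.+2 x u) in T_le.
have EC : C ^+ 2 = N * d by rewrite frob_norm_sqr frob_dtpow_tangent // uu.
have C0 : 0 <= C by exact: frob_norm_ge0.
have main : N * (W * d * e) <= Delta * C.
  apply: le_trans T_le; apply: ler_wpM2l; first exact: ler0n.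
  have EW : W * d = `|dotp x (a i) ^+ k.+2 * dotp x (a i) ^+ k.+1 * d|.
    by rewrite !normrM !normrX -/m (ger0_norm d0).
  set X := dotp x (a i) ^+ k.+2 * dotp x (a i) ^+ k.+1 * d in EW *.
  set Y := s i * _ in R1 *.
  have tri : `|X| <= `|X + Y + S| + `|Y| + `|S|.
    have {1}-> : X = X + Y + S + (- Y) + (- S) by ring.
    apply: (le_trans (ler_normD _ _)); rewrite normrN lerD2r.
    by apply: (le_trans (ler_normD _ _)); rewrite normrN.
  have Wd0 : 0 <= W * d by exact: mulr_ge0.
  have := ler_wpM2r Wd0 he; rewrite -EW in tri; lra.
have EW2 : W ^+ 2 = mu ^+ (2 * k + 3).
  by rewrite -Emu /W sqrX_merge.
have [d_0|d_n0] := eqVneq d 0.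
  by rewrite d_0 mulr0 !mul0r sqr_ge0.
have d_gt0 : 0 < d by rewrite lt_def d_n0.
have N0 : 0 < N by lra.
rewrite -EW2 -(ler_pM2l (mulr_gt0 N0 d_gt0)).
have -> : N * d * (N * d * W ^+ 2 * e ^+ 2) = (N * (W * d * e)) ^+ 2 by ring.
have -> : N * d * Delta ^+ 2 = (Delta * C) ^+ 2 by rewrite exprMn EC mulrC.
apply: lerXn2r main; rewrite nnegrE; last first.
  by apply: mulr_ge0 => //; exact: Delta_ge0.
by apply: mulr_ge0; [exact: ltW | do ![apply: mulr_ge0 => //]].
Qed.

End GradientEstimate.

(** * Numerical consequences of the two estimates *)

Lemma product_budget (R : realFieldType) (X Y Z : R) :
    0 <= X -> 0 <= Y -> 0 <= Z -> X + Y + Z <= 1 / 14 ->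
  (1 + X) * (1 + Y) * (1 + Z) <= 27 / 25.
Proof.
move=> X0 Y0 Z0 h.
have sq : (X + Y + Z) * (X + Y + Z) <= 1 / 14 * (1 / 14).
  by apply: ler_pM => //; do ![apply: addr_ge0 => //].
have X2 := mulr_ge0 X0 X0; have Y2 := mulr_ge0 Y0 Y0; have Z2 := mulr_ge0 Z0 Z0.
have hXY : X * Y <= X * (1 / 14) by apply: ler_wpM2l => //; lra.
have hXYZ : X * Y * Z <= X * (1 / 14) * (1 / 14).
  by apply: ler_pM => //; [exact: mulr_ge0 | lra].
lra.
Qed.

(** Here [M = mu ^+ (n - 1)], [d = 1 - mu] and [e] is the noise. Inserting the upper bound for [F]
    and dividing by [M] bounds the right side by [(1 + r2) * (1 + Y) * (1 + Z)]. The factor 3/7 is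
    the value at [N = 2] of [2 * (N + 1) / (2 + 3 * N ^+ 2)]; as it also suits the other two terms,
    the three increments sum to at most 3/7 of the budget 1/6, that is 1/14. *)
Lemma rough_distance (R : realFieldType) (N r2 rn t c M d e F : R) :
    2 <= N -> 0 <= r2 -> 0 <= rn -> 0 <= t ->
    N ^+ 2 * r2 + (N ^+ 2 + N) * rn + t = 6^-1 ->
    1 <= c <= 36 / 35 -> rn * c = c - 1 -> 0 < M -> 0 <= e ->
    (2 * N - 1) * (M * d) <= (N - 1) * (rn * c * (1 + r2)) * M + N * e + F ->
    F - e <= M * ((1 + r2) * c) -> (2 + 3 * N ^+ 2) * e <= 2 * t * (F - e) ->
  (2 * N - 1) * d <= 27 / 25.
Proof.
move=> N2 r20 rn0 t0 bud /andP[c1 c2] Ec M0 e0 hH hF he.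
have e6 : 6^-1 = 1 / 6 :> R by rewrite div1r.
rewrite e6 in bud.
set L := (1 + r2) * c in hF.
have L0 : 0 <= L by apply: mulr_ge0; lra.
have N4 : 4 <= N ^+ 2 by nra.
have hN : 7 * (2 * (N + 1)) <= 3 * (2 + 3 * N ^+ 2).
  have : 0 <= (N - 2) * (9 * N + 4) by apply: mulr_ge0; lra.
  lra.
have ML0 : 0 <= M * L by apply: mulr_ge0 => //; exact: ltW.
have p0 : 0 < 2 + 3 * N ^+ 2 by lra.
have Ne : (N + 1) * e <= 3 / 7 * t * (M * L).
  rewrite -(ler_pM2l p0).
  have h1 : (2 + 3 * N ^+ 2) * e <= 2 * t * (M * L).
    by apply: (le_trans he); apply: ler_wpM2l => //; lra.
  have h2 : (N + 1) * ((2 + 3 * N ^+ 2) * e) <= (N + 1) * (2 * t * (M * L)).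
    by apply: ler_wpM2l => //; lra.
  have h3 : 7 * (2 * (N + 1)) * (t * (M * L)) <= 3 * (2 + 3 * N ^+ 2) * (t * (M * L)).
    by apply: ler_wpM2r => //; exact: mulr_ge0.
  lra.
pose Y := N * (c - 1); pose Z := 3 / 7 * t.
have Y0 : 0 <= Y by apply: mulr_ge0; lra.
have Z0 : 0 <= Z by rewrite /Z; lra.
have hr2 : r2 <= 3 / 7 * (N ^+ 2 * r2).
  have := ler_wpM2r r20 N4; lra.
have hY : Y <= 3 / 7 * ((N ^+ 2 + N) * rn).
  rewrite /Y -Ec.
  have : c * (N * rn) <= 3 / 7 * (N + 1) * (N * rn).
    by apply: ler_wpM2r; [apply: mulr_ge0; lra | lra].
  lra.
have bd := product_budget r20 Y0 Z0; apply: le_trans (bd _); last by rewrite /Z; lra.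
rewrite -(ler_pM2l M0).
have hc : c * (1 + r2) * Z <= (1 + Y) * (1 + r2) * Z.
  apply: ler_wpM2r => //; apply: ler_wpM2r; first by lra.
  have : 0 <= (N - 1) * (c - 1) by apply: mulr_ge0; lra.
  rewrite /Y; lra.
have hcM : M * (c * (1 + r2) * Z) <= M * ((1 + Y) * (1 + r2) * Z).
  by apply: ler_wpM2l => //; exact: ltW.
move: hH; rewrite Ec.
have -> : (N - 1) * ((c - 1) * (1 + r2)) * M
    = M * ((1 + r2) * (1 + Y)) - M * L by rewrite /Y /L; ring.
have -> : M * ((2 * N - 1) * d) = (2 * N - 1) * (M * d) by ring.
move: hcM; rewrite /Z /L in Ne hF *; lra.
Qed.

(* The gradient estimate is used twice: with the rough bound [1 - mu <= 9 / 25] it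
   yields [N * (1 - mu) <= 7 / 50], and with this better bound its constant
   becomes small enough for the claim. *)
Lemma bootstrap_distance (R : realFieldType) (N mu r2 rn c M M' D : R) :
    (forall Bd G H Dd e : R, 0 <= Bd -> 0 <= G -> 0 <= H -> 0 <= Dd -> Bd + G <= 1 ->
      0 < mu -> 1 - mu + r2 <= Bd ^+ 2 * mu -> r2 <= G ^+ 2 ->
      mu + r2 <= H ^+ 2 * mu -> 1 - mu <= Dd ^+ 2 * mu ->
      ((Bd + G) * Bd * H + rn * Dd) * c <= 1 - e -> 0 <= e ->
      N * (1 - mu) * (M * M') * e ^+ 2 <= D ^+ 2) ->
    2 <= N -> 0 <= r2 -> r2 <= 1 / 24 -> 0 <= rn -> rn <= 1 / 36 ->
    1 <= c <= 36 / 35 -> 0 < M -> M' <= M -> 1 - N * (1 - mu) <= M' ->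
    mu <= 1 -> 1 - mu <= 9 / 25 -> N * (1 - mu) <= 18 / 25 ->
    0 <= D -> D <= 1 / 42 -> D <= 5 / 196 * M ->
  N * (1 - mu) <= D / 10.
Proof.
move=> Gr N2 r20 r21 rn0 rn1 /andP[c11 c12] M_pos ML bern mu1 d1 Nd1 D0 D42 DM.
have d0 : 0 <= 1 - mu by lra.
have mu0 : 0 < mu by lra.
have Nd0 : 0 <= N * (1 - mu) by apply: mulr_ge0 => //; lra.
(* The constraint is monotone in [rn] and [c], so it is enough to check it at 1/36 and 36/35. *)
have kappa (P Dd e : R) : 0 <= P -> 0 <= Dd -> (P + 1 / 36 * Dd) * (36 / 35) <= 1 - e ->
    (P + rn * Dd) * c <= 1 - e.
  clear - rn0 rn1 c11 c12 => P0 Dd0 h; apply: le_trans h; apply: ler_pM => //.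
  - by apply: addr_ge0 => //; exact: mulr_ge0.
  - by lra.
  - by rewrite lerD2l; apply: ler_wpM2r.
have step1 : N * (1 - mu) <= 7 / 50.
  have g : N * (1 - mu) * (M * M') * (1 / 8) ^+ 2 <= D ^+ 2.
    (* Rational upper bounds for the roots in the worst case [1 - mu = 9 / 25], [r2 = 1 / 24]. Here
       3/4 is exact, and [Bd + G <= 1] holds only barely. *)
    { apply: (Gr (23 / 29) (7 / 34) (32 / 31) (3 / 4)); last 2 first.
    - by apply: kappa; lra.
    - by lra.
    all: by clear - r20 r21 d0 d1; lra. }
  (* One factor [D] is traded for [M], which has no lower bound yet and thereby cancels; [M'] is at
     least [7 / 25 = 1 - 18 / 25] by Bernoulli. *)
  have g2 : D ^+ 2 <= D * (5 / 196 * M) by rewrite expr2; apply: ler_wpM2l.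
  have g3 : N * (1 - mu) * M' * (1 / 8) ^+ 2 <= D * (5 / 196).
    by rewrite -(ler_pM2l M_pos); clear - g g2; lra.
  have g4 : N * (1 - mu) * (7 / 25) <= N * (1 - mu) * M'.
    by apply: ler_wpM2l => //; lra.
  by clear - g3 g4 D42; lra.
have d2 : 1 - mu <= 7 / 100.
  have : 2 * (1 - mu) <= N * (1 - mu) by exact: ler_wpM2r.
  by clear - step1; lra.
have g : N * (1 - mu) * (M * M') * (3 / 4) ^+ 2 <= D ^+ 2.
  (* The same roots, now for [1 - mu = 7 / 100]. *)
  { apply: (Gr (7 / 20) (7 / 34) (46 / 45) (2 / 7)); last 2 first.
  - by apply: kappa; lra.
  - by lra.
  all: by clear - r20 r21 d0 d2; lra. }
have g2 : D ^+ 2 <= D * (1 / 42) by rewrite expr2; apply: ler_wpM2l.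
have MM' : 7 / 10 <= M * M'.
  (* [43 / 50 = 1 - 7 / 50], again by Bernoulli. *)
  have : (43 / 50) * (43 / 50) <= M * M'.
    by apply: ler_pM; clear - bern step1 ML; lra.
  lra.
have g3 : N * (1 - mu) * (7 / 10) <= N * (1 - mu) * (M * M').
  by apply: ler_wpM2l.
by clear - g g2 g3 D0; lra.
Qed.

(** * High critical points lie close to an axis *)

Section CriticalPoints.
Variables (R : realType) (D K k : nat) (a : 'I_K -> 'rV[R]_D).
Variable B : {vspace tensor R D k.+2}.
Hypothesis ha : forall i, sphere (a i).
Hypothesis tau_ge0 : 0 <= tau k.+2 a.
Implicit Types (x y z : 'rV[R]_D) (i j : 'I_K).

Local Notation N := (k.+2%:R : R).
Local Notation r2 := (rho a 2).
Local Notation rn := (rho a k.+2).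
Local Notation c1 := ((1 - rho a k.+2)^-1).
Local Notation A := (spanA k.+2 a).
Local Notation PB x := (oproj B (tpow k.+2 x)).
Local Notation Delta := (DeltaA a B).
Local Notation t := (tau k.+2 a).

(** A positive value rules out the empty frame, on whose span the projection is 0. *)
Lemma argmax_exists x : 0 < Fobj A x ->
  exists i, forall j, `|dotp x (a j)| <= `|dotp x (a i)|.
Proof.
move=> F0; have [i0|noi] := pickP (xpredT : pred 'I_K).
  by move=> _; have [i _ hi] := arg_maxP (fun j => `|dotp x (a j)|) (erefl (xpredT i0));
     exists i => j; exact: hi.
have [s [Es _]] := oproj_spanA a (tpow k.+2 x).
move: F0; rewrite FobjE (frob_PA_sum _ Es) big1 ?ltxx // => i _.
by have := noi i.
Qed.

Lemma sqr_dotp_le1 x i : sphere x -> dotp x (a i) ^+ 2 <= 1.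
Proof.
move=> hx; rewrite -(real_normK (num_real _)) -[1](expr1n _ 2).
by apply: lerXn2r; rewrite ?nnegrE // dotp_sphere_le1.
Qed.

Lemma Bernoulli_dotp x i : sphere x ->
  1 - N * (1 - dotp x (a i) ^+ 2) <= (dotp x (a i) ^+ 2) ^+ k.+2.
Proof.
move=> hx; have := @one_sub_exp_le R k.+2 (dotp x (a i) ^+ 2).
rewrite ger0_norm ?sqr_ge0 // => /(_ (sqr_dotp_le1 i hx)); lra.
Qed.

Lemma critical_close x : second_order_critical (Fobj B) x ->
    0 < Fobj B x - Delta ->
    (2 + 3 * N ^+ 2) * Delta <= 2 * t * (Fobj B x - Delta) ->
  exists i, N * (1 - dotp x (a i) ^+ 2) <= Delta / 10 /\ N * Delta <= 1 / 21.
Proof.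
move=> hcrit f0 hf; have [hx hgrad _] := (second_order_criticalE B x).1 hcrit.
have fA : Fobj B x - Delta <= Fobj A x.
  by have := Fobj_close a B hx; rewrite ler_norml; lra.
have [i hi] := argmax_exists (lt_le_trans f0 fA).
exists i; have [r20 rn0 r21 rn1 t1] := rho_small ha tau_ge0 i.
have c1b := c1_bounds ha tau_ge0 i.
have N2 := N_ge2 R k; have D0 := Delta_ge0 a B.
have F1 := Fobj_le1 k a hx.
have F_up := le_trans fA (Fobj_upper ha tau_ge0 hx hi).
have grad0 : frob (PB x) (dtpow k.+2 x (rejection a x i)) = 0.
  by have [ux _ _] := rejection_facts ha i hx; rewrite hgrad ux mulr0.
have hess := @hessian_at_rejection _ _ _ _ _ _ ha tau_ge0 x i hcrit hi.
have mu1 := sqr_dotp_le1 i hx; have bern := Bernoulli_dotp i hx.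
have Gr Bd G H Dd e := @gradient_at_rejection _ _ _ _ _ B ha tau_ge0 x i Bd G H Dd e hx grad0.
have E3 : (dotp x (a i) ^+ 2) ^+ (2 * k + 3)
    = (dotp x (a i) ^+ 2) ^+ k.+1 * (dotp x (a i) ^+ 2) ^+ k.+2.
  by rewrite -exprD; congr (_ ^+ _); rewrite mul2n -addnn !addSn !addnS !addn0.
rewrite {}E3 in Gr.
have ML : (dotp x (a i) ^+ 2) ^+ k.+2 <= (dotp x (a i) ^+ 2) ^+ k.+1.
  by rewrite exprS; apply: ler_piMl => //; apply: exprn_ge0; exact: sqr_ge0.
have M_pos : 0 < (dotp x (a i) ^+ 2) ^+ k.+1.
  rewrite lt_def exprn_ge0 ?sqr_ge0 // andbT; apply: contraTneq F_up => ->.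
  by rewrite mul0r -ltNge.
set mu := dotp x (a i) ^+ 2 in hess mu1 bern Gr ML M_pos F_up *.
set M := mu ^+ k.+1 in F_up hess Gr ML M_pos.
set M' := mu ^+ k.+2 in bern Gr ML.
set D_ := Delta in D0 f0 hf fA hess Gr F_up *.
set F := Fobj B x in f0 hf fA hess F_up.
clear hgrad grad0 hi hcrit.
have N4 : 4 <= N ^+ 2 by nra.
have D14 : 14 * D_ <= 1 / 3 * (F - D_).
  have h1 : 14 * D_ <= (2 + 3 * N ^+ 2) * D_ by apply: ler_wpM2r => //; lra.
  have h2 : 2 * t * (F - D_) <= 1 / 3 * (F - D_).
    by apply: ler_wpM2r; [exact: ltW | lra].
  lra.
have D42 : D_ <= 1 / 42 by lra.
split; last first.
  have h1 : 7 * N * D_ <= (2 + 3 * N ^+ 2) * D_.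
    apply: ler_wpM2r => //; have : 0 <= (3 * N - 1) * (N - 2) by apply: mulr_ge0; lra.
    lra.
  have h2 : 2 * t * (F - D_) <= 1 / 3 * (F - D_).
    by apply: ler_wpM2r; [exact: ltW | lra].
  lra.
have rough : (2 * N - 1) * (1 - mu) <= 27 / 25.
  have [d0|d0] := ltP 0 (1 - mu); last first.
    have : (2 * N - 1) * (1 - mu) <= 0 by apply: mulr_ge0_le0 => //; lra.
    lra.
  exact: (rough_distance N2 r20 rn0 tau_ge0 (budget k a) c1b
    (c1E ha tau_ge0 i) M_pos D0 (hess d0) F_up hf).
have d0 : 0 <= 1 - mu by lra.
(* Since [N >= 2], the rough bound gives [3 * d <= 27 / 25]; it then reads
   [2 * N * d <= 27 / 25 + 9 / 25]. *)
have d1 : 1 - mu <= 9 / 25.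
  have : 2 * (1 - mu) <= N * (1 - mu) by exact: ler_wpM2r.
  lra.
have Nd1 : N * (1 - mu) <= 18 / 25 by lra.
have mu0 : 0 < mu by lra.
move: c1b => /andP[c11 c12].
(* [14 * D_] is at most a third of [F - D_], which is at most [15 / 14 * M]. *)
have DM : D_ <= 5 / 196 * M.
  have : (1 + r2) * c1 <= 25 / 24 * (36 / 35) by apply: ler_pM; lra.
  by move/(ler_wpM2l (ltW M_pos)); clear - F_up D14; lra.
apply: (@bootstrap_distance R N mu r2 rn c1 M M') => //; first by rewrite c11.
Qed.

End CriticalPoints.

(** * Uniqueness in a cap *)

Lemma subrX_norm_max (R : realDomainType) (x y M : R) p :
  `|x| <= M -> `|y| <= M -> `|x ^+ p.+1 - y ^+ p.+1| <= p.+1%:R * (`|x - y| * M ^+ p).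
Proof.
move=> hx hy; have M0 : 0 <= M by apply: le_trans hx.
rewrite subrXX normrM mulrCA; apply: ler_wpM2l => //.
rewrite mulr_natl -[X in _ *+ X]card_ord -sumr_const.
apply: (le_trans (ler_norm_sum _ _ _)); apply: ler_sum => i _.
rewrite normrM !normrX.
have -> : M ^+ p = M ^+ (p - i) * M ^+ i by rewrite -exprD subnK // -ltnS.
by apply: ler_pM; rewrite ?exprn_ge0 //; apply: lerXn2r; rewrite ?nnegrE.
Qed.

Lemma budget_halves (R : realFieldType) (N r2 rn t : R) :
    2 <= N -> 0 <= r2 -> 0 <= rn -> 0 <= t ->
    N ^+ 2 * r2 + (N ^+ 2 + N) * rn + t = 6^-1 ->
  N * r2 <= 1 / 12 /\ N * rn <= 1 / 18.
Proof.
move=> N2 r20 rn0 t0 bud.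
have e6 : 6^-1 = 1 / 6 :> R by rewrite div1r.
have Nr2 : 0 <= N * r2 by apply: mulr_ge0 => //; lra.
have Nrn : 0 <= N * rn by apply: mulr_ge0 => //; lra.
have h1 := ler_wpM2r Nr2 N2; have h2 := ler_wpM2r Nrn N2.
by split; lra.
Qed.

Section Uniqueness.
Variables (R : realType) (D K k : nat) (a : 'I_K -> 'rV[R]_D).
Variable B : {vspace tensor R D k.+2}.
Hypothesis ha : forall i, sphere (a i).
Hypothesis tau_ge0 : 0 <= tau k.+2 a.
Implicit Types (x y z : 'rV[R]_D) (i j : 'I_K).

Local Notation N := (k.+2%:R : R).
Local Notation r2 := (rho a 2).
Local Notation rn := (rho a k.+2).
Local Notation c1 := ((1 - rho a k.+2)^-1).
Local Notation A := (spanA k.+2 a).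
Local Notation PA x := (oproj A (tpow k.+2 x)).
Local Notation PB x := (oproj B (tpow k.+2 x)).
Local Notation Delta := (DeltaA a B).

Lemma near_axis_other x i e : sphere x -> 1 - dotp x (a i) ^+ 2 + r2 <= e ^+ 2 ->
  \sum_(j | j != i) dotp x (a j) ^+ 2 <= e ^+ 2.
Proof.
move=> hx h; apply: le_trans h.
have := frame_upper ha x; rewrite (sphereE x).1 // (bigD1 i) //=; lra.
Qed.

(** On the sphere [x - y] is orthogonal to [x + y], so [a i] may be replaced by half of [v], up to
    the sign [s]; this vector is short when both points are near [s *: a i]. Thus differences within
    a cap are almost orthogonal to the axis. *)
Lemma near_axis_diff x y i s : sphere x -> sphere y -> s ^+ 2 = 1 ->
    0 <= s * dotp x (a i) -> 0 <= s * dotp y (a i) ->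
  dotp (x - y) (a i) ^+ 2 <= dotp (x - y) (x - y) *
    ((1 - dotp x (a i) ^+ 2) + (1 - dotp y (a i) ^+ 2)).
Proof.
move=> hx hy s1 px py; pose v := 2 *: (s *: a i) - (x + y).
have x1 := (sphereE x).1 hx; have y1 := (sphereE y).1 hy.
have a1 := (sphereE (a i)).1 (ha i).
have c1 : dotp x y <= 1.
  by apply: le_trans (dotp_sphere_le1 hx hy); exact: ler_norm.
have E1 : dotp (x - y) v = 2 * s * dotp (x - y) (a i).
  by rewrite /v !dotpE x1 y1 (dotpC y x); ring.
have E2 : dotp v v <= 4 * ((1 - s * dotp x (a i)) + (1 - s * dotp y (a i))).
  have -> : dotp v v = 4 * s ^+ 2 + 2 + 2 * dotp x y
      - 4 * (s * dotp x (a i)) - 4 * (s * dotp y (a i)).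
    rewrite /v !dotpE x1 y1 a1 (dotpC y x) (dotpC (a i) x) (dotpC (a i) y); ring.
  rewrite s1; lra.
have sq z : sphere z -> 0 <= s * dotp z (a i) ->
    1 - s * dotp z (a i) <= 1 - dotp z (a i) ^+ 2.
  move=> hz pz; have -> : dotp z (a i) ^+ 2 = (s * dotp z (a i)) ^+ 2.
    by rewrite exprMn s1 mul1r.
  rewrite lerD2l lerN2 expr2; apply: ler_piMr => //.
  apply: (le_trans (ler_norm _)); rewrite -[X in _ <= X]mulr1 normrM.
  apply: ler_pM => //; last exact: dotp_sphere_le1.
  by apply: ler_norm_sqr; rewrite ?s1 ?expr1n.
have := dotp_CS (x - y) v; rewrite E1 !exprMn s1 mulr1.
have w0 := dotp_ge0 (x - y).
have h3 : dotp v v <= 4 * ((1 - dotp x (a i) ^+ 2) + (1 - dotp y (a i) ^+ 2)).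
  by have := sq x hx px; have := sq y hy py; lra.
have := ler_wpM2l w0 h3; lra.
Qed.

Lemma Fobj_lower x i : sphere x ->
  1 - N * (1 - dotp x (a i) ^+ 2) - Delta <= Fobj B x.
Proof.
move=> hx; have := Fobj_close a B hx; rewrite ler_norml => /andP[_ h].
have := frob_oproj_ge (tpow k.+2 x) (spanA_mem a k.+2 i).
rewrite -FobjE !frob_tpow (sphereE (a i)).1 // expr1n => /(_ erefl).
have := Bernoulli_dotp k ha i hx.
by rewrite -exprM mulnC exprM; lra.
Qed.

(* With [w = x - y], both gradient equations tested against [w] give
   [N * (Fobj B x + Fobj B y) / 2 * dotp w w] on one side; all terms on the other
   side are quadratic in [w] with small constants. *)
Lemma critical_unique x y i s : sphere x -> sphere y ->
    (forall z, frob (PB x) (dtpow k.+2 x z) = N * Fobj B x * dotp z x) ->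
    (forall z, frob (PB y) (dtpow k.+2 y z) = N * Fobj B y * dotp z y) ->
    s ^+ 2 = 1 -> 0 <= s * dotp x (a i) -> 0 <= s * dotp y (a i) ->
    N * (1 - dotp x (a i) ^+ 2) <= Delta / 10 ->
    N * (1 - dotp y (a i) ^+ 2) <= Delta / 10 ->
    N * Delta <= 1 / 21 ->
  x = y.
Proof.
move=> hx hy gx gy s1 px py dx dy hD.
have x1 := (sphereE x).1 hx; have y1 := (sphereE y).1 hy.
have [r20 rn0 r21 rn1 _] := rho_small ha tau_ge0 i.
have /andP[c11 c12] := c1_bounds ha tau_ge0 i; have c10 : 0 <= c1 by lra.
have N2 := N_ge2 R k; have D0 := Delta_ge0 a B.
have N0 : 0 < N by lra.
have D42 : Delta <= 1 / 42.
  by have := ler_wpM2r D0 N2; lra.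
pose w := x - y; pose W := enorm w.
have W0 : 0 <= W by exact: enorm_ge0.
have EW : W ^+ 2 = dotp w w by exact: enorm_sqr.
have wx : dotp w x = W ^+ 2 / 2.
  by rewrite EW /w !dotpE x1 y1 (dotpC y x); field.
have wy : dotp w y = - (W ^+ 2 / 2).
  by rewrite EW /w !dotpE x1 y1 (dotpC y x); field.
(* Chosen so that [N * (d + r2) <= Delta / 10 + 1 / 12 <= 1 / 11 = N * e ^+ 2] at both points, with
   [d] the distance term of the cap. *)
pose e := Num.sqrt (11 * N)^-1.
have Ne0 : 0 <= (11 * N)^-1 by rewrite invr_ge0; lra.
have e0 : 0 <= e by exact: sqrtr_ge0.
have Ee : e ^+ 2 = (11 * N)^-1 by rewrite sqr_sqrtr.
have Nee : N * e ^+ 2 = 1 / 11 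
  by rewrite Ee invfM mulrCA divff ?mulr1 ?div1r // gt_eqF.
have e1 : e <= 1.
  rewrite -(expr_le1 (n := 2)) // -(ler_pM2l N0) Nee; lra.
have [r2N rnN] := budget_halves N2 r20 rn0 tau_ge0 (budget k a).
have near_e z : N * (1 - dotp z (a i) ^+ 2) <= Delta / 10 ->
    1 - dotp z (a i) ^+ 2 + r2 <= e ^+ 2.
  by move=> hz; rewrite -(ler_pM2l N0) Nee mulrDr; clear - ha tau_ge0 hz r2N D42; lra.
have wi : `|dotp w (a i)| <= e * W.
  apply: ler_norm_sqr; first exact: mulr_ge0.
  apply: (le_trans (near_axis_diff hx hy s1 px py)).
  rewrite exprMn EW mulrC; apply: ler_wpM2r; first exact: dotp_ge0.
  by rewrite -(ler_pM2l N0) Nee; clear - ha tau_ge0 dx dy D42; lra.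
have wj j : `|dotp w (a j)| <= W.
  by have := dotp_norm_le w (a j); rewrite [enorm (a j)]ha mulr1.
have hzx := near_axis_other hx (near_e x dx).
have hzy := near_axis_other hy (near_e y dy).
have other z j : \sum_(l | l != i) dotp z (a l) ^+ 2 <= e ^+ 2 -> j != i ->
    `|dotp z (a j)| <= e.
  move=> hz ji; apply: ler_norm_sqr => //; apply: le_trans hz.
  by rewrite (bigD1 j) //= lerDl; apply: sumr_ge0 => l _; exact: sqr_ge0.
have hw : \sum_j dotp w (a j) ^+ 2 <= 25 / 24 * W ^+ 2.
  apply: (le_trans (frame_upper ha w)); rewrite EW; apply: ler_wpM2r.
    exact: dotp_ge0.
  by clear - ha tau_ge0 r21; lra.
have W20 : 0 <= W ^+ 2 by exact: sqr_ge0.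
have hw' : \sum_(j | j != i) dotp w (a j) ^+ 2 <= (103 / 100 * W) ^+ 2.
  have := hw; rewrite (bigD1 i) //= exprMn; have := sqr_ge0 (dotp w (a i)).
  by clear - ha tau_ge0 W20; lra.
have [sx [Ex hsx]] := oproj_spanA a (tpow k.+2 x).
have one_ub j : `|dotp y (a j)| <= 1 by exact: dotp_sphere_le1.
have [sy [Ey hsy]] := oproj_spanA a (tpow k.+2 y).
have one_ubx j : `|dotp x (a j)| <= 1 by exact: dotp_sphere_le1.
have rn_lt1 : rn < 1 by lra.
have sy_b := @gram_inverse_sup R D K a ha k.+2 sy (fun l => dotp y (a l) ^+ k.+2) 1 rn_lt1.
have {}sy_b j : `|sy j| <= c1 /\ `|sy j - dotp y (a j) ^+ k.+2| <= rn * c1.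
  have := sy_b _ _ j; rewrite mul1r; apply=> l; first by rewrite hsy frob_tpow.
  by rewrite normrX exprn_ile1.
(* Bounds the differences of the [n]-th powers of correlations: at [i] the factor [e] comes from the
   near orthogonality of [w] to the axis, elsewhere from the smallness of the correlations
   themselves. *)
pose Q := N * (W * e).
have Q0 : 0 <= Q by apply: mulr_ge0; [exact: ltW | exact: mulr_ge0].
have th_b j : `|sx j - sy j| <= Q * c1.
  have h l : \sum_j (sx j - sy j) * dotp (a j) (a l) ^+ k.+2
      = dotp x (a l) ^+ k.+2 - dotp y (a l) ^+ k.+2.
    under eq_bigr do rewrite mulrBl.
    by rewrite sumrB hsx hsy !frob_tpow.
  have hq l : `|dotp x (a l) ^+ k.+2 - dotp y (a l) ^+ k.+2| <= Q.
    have Ew : dotp x (a l) - dotp y (a l) = dotp w (a l) by rewrite dotpBl.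
    have [->|li] := eqVneq l i.
      apply: (le_trans (subrX_norm_max _ (one_ubx i) (one_ub i))).
      apply: ler_wpM2l; first exact: ltW.
      by rewrite expr1n mulr1 -dotpBl mulrC.
    apply: (le_trans (subrX_norm_max _ (other x l hzx li) (other y l hzy li))).
    apply: ler_wpM2l; first exact: ltW.
    rewrite Ew; apply: ler_pM => //; first exact: exprn_ge0.
    by rewrite exprS; apply: ler_piMr => //; exact: exprn_ile1.
  by have [] := gram_inverse_sup ha rn_lt1 h hq j.
have sumx : frob (PA x) (dtpow k.+2 x w)
    = N * \sum_j sx j * (dotp x (a j) ^+ k.+1 * dotp w (a j)).
  rewrite (frob_PA_sum _ Ex) mulr_sumr; apply: eq_bigr => j _.
  by rewrite frob_dtpow /= mulrCA.
have sumy : frob (PA y) (dtpow k.+2 y w)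
    = N * \sum_j sy j * (dotp y (a j) ^+ k.+1 * dotp w (a j)).
  rewrite (frob_PA_sum _ Ey) mulr_sumr; apply: eq_bigr => j _.
  by rewrite frob_dtpow /= mulrCA.
(* A discrete product rule: [S1] collects the change of the coefficients, [S2] the change of the
   powers. *)
pose S1 := \sum_j (sx j - sy j) * (dotp x (a j) ^+ k.+1 * dotp w (a j)).
pose S2 := \sum_j sy j * ((dotp x (a j) ^+ k.+1 - dotp y (a j) ^+ k.+1) * dotp w (a j)).
have ES : frob (PA x) (dtpow k.+2 x w) - frob (PA y) (dtpow k.+2 y w) = N * (S1 + S2).
  rewrite sumx sumy -mulrBr; congr (_ * _).
  by rewrite /S1 /S2 -sumrB -big_split /=; apply: eq_bigr => j _; ring.
have S1_le : S1 <= 19 / 100 * W ^+ 2.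
  apply: (@le_trans _ _ (Q * c1 * (e * W + e * (103 / 100 * W)))).
    apply: (@le_trans _ _ (Q * c1 * \sum_j `|dotp x (a j)| ^+ k.+1 * `|dotp w (a j)|)).
      rewrite mulr_sumr; apply: ler_sum => j _; apply: (le_trans (ler_norm _)).
      rewrite !normrM normrX; apply: ler_wpM2r; last exact: th_b.
      by apply: mulr_ge0; [exact/exprn_ge0/normr_ge0 | exact: normr_ge0].
    apply: ler_wpM2l; first exact: mulr_ge0.
    rewrite (bigD1 i) //=; apply: lerD.
      rewrite -[leRHS]mul1r; apply: ler_pM; last exact: wi.
      - exact/exprn_ge0/normr_ge0.
      - exact: normr_ge0.
      - exact: exprn_ile1.
    apply: le_trans (sum_norm_le e0 _ hzx hw'); last by apply: mulr_ge0 => //; lra.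
    apply: ler_sum => j _; apply: ler_wpM2r => //.
    by rewrite exprS; apply: ler_piMr => //; exact: exprn_ile1.
  have E c : Q * c * (e * W + e * (103 / 100 * W))
      = c * (203 / 100 * (N * e ^+ 2) * W ^+ 2) by rewrite /Q; field.
  rewrite E Nee.
  have : c1 * (203 / 100 * (1 / 11) * W ^+ 2) <= 36 / 35 * (203 / 100 * (1 / 11) * W ^+ 2).
    by apply: ler_wpM2r => //; apply: mulr_ge0 => //; lra.
  by clear - ha tau_ge0 W20; lra.
have S2_le : S2 <= 25 / 100 * W ^+ 2.
  have term j C : `|sy j| <= C ->
      sy j * ((dotp x (a j) ^+ k.+1 - dotp y (a j) ^+ k.+1) * dotp w (a j))
      <= C * N * dotp w (a j) ^+ 2.
    move=> hC; apply: (le_trans (ler_norm _)).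
    have -> : C * N * dotp w (a j) ^+ 2 = C * (N * `|dotp w (a j)| * `|dotp w (a j)|).
      by rewrite -(real_normK (num_real (dotp w (a j)))); ring.
    rewrite !normrM; apply: ler_pM; [exact: normr_ge0 | by apply: mulr_ge0 | exact: hC | ].
    apply: ler_wpM2r; first exact: normr_ge0.
    apply: (le_trans (subrX_norm_max _ (one_ubx j) (one_ub j))).
    rewrite expr1n mulr1 -dotpBl; apply: ler_wpM2r; first exact: normr_ge0.
    by rewrite ler_nat.
  rewrite /S2 (bigD1 i) //=.
  have T1 := term i c1 (sy_b i).1.
  have T2 : \sum_(j | j != i)
      sy j * ((dotp x (a j) ^+ k.+1 - dotp y (a j) ^+ k.+1) * dotp w (a j))
      <= (e ^+ 2 + rn * c1) * N * (25 / 24 * W ^+ 2).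
    apply: (@le_trans _ _ (\sum_(j | j != i) (e ^+ 2 + rn * c1) * N * dotp w (a j) ^+ 2)).
      apply: ler_sum => j ji; apply: term; have [_ h] := sy_b j.
      have hyj : `|dotp y (a j) ^+ k.+2| <= e ^+ 2.
        rewrite normrX; apply: le_trans (_ : e ^+ k.+2 <= _).
          by apply: lerXn2r; rewrite ?nnegrE // other.
        by rewrite -addn2 exprD; apply: ler_piMl; [exact: sqr_ge0 | exact: exprn_ile1].
      have := ler_normD (sy j - dotp y (a j) ^+ k.+2) (dotp y (a j) ^+ k.+2).
      by rewrite subrK; clear - ha tau_ge0 h hyj; lra.
    rewrite -mulr_sumr; apply: ler_wpM2l.
      apply: mulr_ge0; last exact: ltW.
      by apply: addr_ge0; [exact: sqr_ge0 | exact: mulr_ge0].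
    have := hw; rewrite (bigD1 i) //=; have := sqr_ge0 (dotp w (a i)).
    by lra.
  have wi2 : dotp w (a i) ^+ 2 <= e ^+ 2 * W ^+ 2.
    rewrite -exprMn -(real_normK (num_real (dotp w (a i)))).
    by apply: lerXn2r; rewrite ?nnegrE // mulr_ge0.
  have T1' : c1 * N * dotp w (a i) ^+ 2 <= 36 / 35 * (1 / 11 * W ^+ 2).
    rewrite -Nee -mulrA -(mulrA N); apply: ler_pM => //.
      by apply: mulr_ge0; [exact: ltW | exact: sqr_ge0].
    by apply: ler_wpM2l => //; exact: ltW.
  have T2' : (e ^+ 2 + rn * c1) * N * (25 / 24 * W ^+ 2)
      <= (1 / 11 + 1 / 18 * (36 / 35)) * (25 / 24 * W ^+ 2).
    apply: ler_wpM2r; first by apply: mulr_ge0 => //; lra.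
    rewrite mulrDl mulrC Nee lerD2l mulrAC [rn * N]mulrC; apply: ler_pM => //.
    by apply: mulr_ge0 => //; exact: ltW.
  by clear - ha tau_ge0 T1 T2 T1' T2' W20; lra.
have noise : frob (PB x) (dtpow k.+2 x w) - frob (PB y) (dtpow k.+2 y w)
    <= N * (S1 + S2) + 2 * Delta * N ^+ 2 * W ^+ 2.
  have n1 := frob_proj_close a B (tpow k.+2 x - tpow k.+2 y) (dtpow k.+2 x w).
  have n2 := frob_proj_close a B (tpow k.+2 y) (dtpow k.+2 x w - dtpow k.+2 y w).
  rewrite frob_norm_tpow // mul1r in n2.
  have b1 : Delta * (frob_norm (tpow k.+2 x - tpow k.+2 y) * frob_norm (dtpow k.+2 x w))
      <= Delta * (N * W * (N * W)).
    apply: ler_wpM2l => //; apply: ler_pM; rewrite ?frob_norm_ge0 //.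
      exact: frob_norm_tpowB.
    exact: frob_norm_dtpow.
  have b2 : Delta * frob_norm (dtpow k.+2 x w - dtpow k.+2 y w)
      <= Delta * (N ^+ 2 * (W * W)).
    by apply: ler_wpM2l => //; exact: frob_norm_dtpowB.
  have n1' := le_trans n1 b1; have n2' := le_trans n2 b2.
  rewrite -ES; move: n1' n2'; rewrite !oprojB !frobBl !frobBr !ler_norml.
  by move=> /andP[n1' _] /andP[n2' _]; clear - ha tau_ge0 n1' n2'; lra.
have Fx : 97 / 100 <= Fobj B x by have := Fobj_lower i hx; clear - ha tau_ge0 dx D42; lra.
have Fy : 97 / 100 <= Fobj B y by have := Fobj_lower i hy; clear - ha tau_ge0 dy D42; lra.
rewrite gx gy wx wy in noise.
(* The balance is [97 / 100 > 44 / 100 + 2 / 21]: the left side of the tested equation exceeds the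
   changes and the noise together unless [W] is 0. *)
have h1 : N * (97 / 100 * W ^+ 2) <= N * ((Fobj B x + Fobj B y) / 2 * W ^+ 2).
  apply: ler_wpM2l; first exact: ltW.
  by apply: ler_wpM2r => //; clear - ha tau_ge0 Fx Fy; lra.
have h2 : N * (S1 + S2) <= N * (44 / 100 * W ^+ 2).
  by apply: ler_wpM2l; [exact: ltW | clear - ha tau_ge0 S1_le S2_le; lra].
have h3 : 2 * N * W ^+ 2 * (N * Delta) <= 2 * N * W ^+ 2 * (1 / 21).
  by apply: ler_wpM2l => //; apply: mulr_ge0 => //; apply: mulr_ge0 => //; exact: ltW.
have h4 : N * W ^+ 2 <= 0 by clear - ha tau_ge0 noise h1 h2 h3; lra.
have W2_0 : W ^+ 2 <= 0 by rewrite -(ler_pM2l N0) mulr0.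
have : w = 0 by apply: dotp_eq0; apply/eqP; rewrite -EW eq_le W2_0 W20.
by move/eqP; rewrite subr_eq0 => /eqP.
Qed.

End Uniqueness.

(** * Existence in a cap *)

Lemma card_range_fin (T : finType) (U : Type) (f : T -> U) :
  injective f -> range f #= `I_#|T|.
Proof.
move=> finj.
have h1 : range f #= [set: T] by apply: inj_card_eq => x y _ _; exact: finj.
have h2 : [set: 'I_#|T|] #= [set: T].
  have -> : [set: 'I_#|T|] = range (@enum_rank T).
    by apply/seteqP; split=> // i _; exists (enum_val i) => //; exact: enum_valK.
  by apply: inj_card_eq => x y _ _; exact: enum_rank_inj.
apply: card_eq_trans h1 _; rewrite card_eq_sym.
exact: card_eq_trans card_II h2.
Qed.

Lemma continuous_dotp (R : realType) (D : nat) (f g : 'rV[R]_D -> 'rV[R]_D) :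
  continuous f -> continuous g -> continuous (fun x => dotp (f x) (g x)).
Proof.
move=> cf cg; apply: continuous_bigsum => i.
have c h : continuous h -> continuous (fun x : 'rV[R]_D => (h x : 'rV[R]_D) 0 i).
  move=> ch x.
  exact: (continuous_comp (ch x) (@coord_continuous R 1 D 0 i (h x))).
exact: (continuous_mulfun (c f cf) (c g cg)).
Qed.

Section Conclusion.
Variables (R : realType) (D K k : nat) (a : 'I_K -> 'rV[R]_D).
Variable B : {vspace tensor R D k.+2}.
Hypothesis ha : forall i, sphere (a i).
Hypothesis tau_ge0 : 0 <= tau k.+2 a.
Implicit Types (x y z : 'rV[R]_D) (i j : 'I_K).

Local Notation N := (k.+2%:R : R).
Local Notation r2 := (rho a 2).
Local Notation c1 := ((1 - rho a k.+2)^-1).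
Local Notation Delta := (DeltaA a B).
Local Notation t := (tau k.+2 a).

Implicit Types p q : 'I_K * bool.

Lemma signed_sphere p : sphere (signed a p).
Proof.
by apply/sphereE; rewrite /signed dotpZl dotpZr (sphereE _).1 // mulr1 -expr2 sqrr_sign.
Qed.

Lemma dotp_signed x p : dotp x (signed a p) = (-1) ^+ p.2 * dotp x (a p.1).
Proof. by rewrite /signed dotpZr. Qed.

Lemma dotp_signed_sqr x p : dotp x (signed a p) ^+ 2 = dotp x (a p.1) ^+ 2.
Proof. by rewrite dotp_signed exprMn sqrr_sign mul1r. Qed.

Definition near_axis x p :=
  0 <= dotp x (signed a p) /\ N * (1 - dotp x (a p.1) ^+ 2) <= Delta / 10.

(** Two different indices would violate the frame bound, as [8 / 5 > 1 + rho a 2]; opposite signs at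
    one index would make the inner product 0. *)
Lemma signed_separated x p q : sphere x ->
    0 <= dotp x (signed a p) -> 0 <= dotp x (signed a q) ->
    4 / 5 <= dotp x (a p.1) ^+ 2 -> 4 / 5 <= dotp x (a q.1) ^+ 2 ->
  p = q.
Proof.
case: p q => [i b] [j c] hx; rewrite !dotp_signed /= => pb qc zi zj.
have [r20 _ r21 _ _] := rho_small ha tau_ge0 i.
have ij : i = j.
  apply/eqP; rewrite eq_sym; apply/negPn/negP => ji.
  by have := other_dotp_le ha hx ji; lra.
move: pb qc zi; rewrite {}ij; case: b; case: c => //=;
  rewrite !(expr0, expr1, mul1r, mulN1r) => h1 h2 h3; exfalso;
  (have z0 : dotp x (a j) = 0 by lra); move: h3; rewrite z0 expr0n /=; lra.
Qed.

Lemma dotp_signed_ge x p : sphere x -> 0 <= dotp x (signed a p) ->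
  dotp x (a p.1) ^+ 2 <= dotp x (signed a p).
Proof.
move=> hx h; rewrite -dotp_signed_sqr expr2; apply: ler_piMr => //.
by apply: (le_trans (ler_norm _)); apply: dotp_sphere_le1 => //; exact: signed_sphere.
Qed.

Lemma enorm_signed x p : sphere x ->
  enorm (x - signed a p) ^+ 2 = 2 - 2 * dotp x (signed a p).
Proof.
move=> hx; rewrite enorm_sqr !dotpBl !dotpBr (sphereE x).1 //.
by rewrite (sphereE (signed a p)).1 ?(dotpC (signed a p) x); [ring | exact: signed_sphere].
Qed.

Lemma near_axis_sqr x p : near_axis x p -> N * Delta <= 1 / 21 ->
  4 / 5 <= dotp x (a p.1) ^+ 2.
Proof.
move=> [_ h] hD; have N2 := N_ge2 R k; have D0 := Delta_ge0 a B.
have h1 := ler_wpM2r D0 N2.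
have [d0|d0] := leP 0 (1 - dotp x (a p.1) ^+ 2); last by lra.
by have := ler_wpM2r d0 N2; lra.
Qed.

Lemma critical_near_axis x : second_order_critical (Fobj B) x ->
    0 < Fobj B x - Delta ->
    (2 + 3 * N ^+ 2) * Delta <= 2 * t * (Fobj B x - Delta) ->
  exists p, near_axis x p /\ N * Delta <= 1 / 21.
Proof.
move=> hc f0 hf; have [i [hi hD]] := critical_close ha tau_ge0 hc f0 hf.
exists (i, dotp x (a i) < 0); split=> //; split=> //=.
rewrite dotp_signed /=; case: ltP => [h|h]; last by rewrite expr0 mul1r.
by rewrite expr1 mulN1r oppr_ge0 ltW.
Qed.

Lemma near_axis_unique x y p :
    second_order_critical (Fobj B) x -> second_order_critical (Fobj B) y ->
    near_axis x p -> near_axis y p -> N * Delta <= 1 / 21 ->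
  x = y.
Proof.
move=> /second_order_criticalE [hx gx _] /second_order_criticalE [hy gy _].
move=> [px dx] [py dy] hD.
apply: (critical_unique ha tau_ge0 hx hy gx gy (s := (-1) ^+ p.2) _ _ _ dx dy hD).
- exact: sqrr_sign.
- by rewrite -dotp_signed.
- by rewrite -dotp_signed.
Qed.

(* A point with [dotp x (a p.1) ^+ (2 * (n - 1)) = 4 / 5] has objective at most
   6 / 7 + Delta, which is less than the value at the center [signed a p]. *)
Definition region p : set 'rV[R]_D :=
  [set x | [/\ dotp x x = 1, 0 <= dotp x (signed a p)
             & 4 / 5 <= (dotp x (a p.1) ^+ 2) ^+ k.+1]].

Lemma continuous_dotp_id y : continuous (fun x : 'rV[R]_D => dotp x y).
Proof.
apply: (@continuous_dotp _ _ id (cst y)); first by move=> x; exact: cvg_id.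
exact: cst_continuous.
Qed.

Lemma continuous_dotp_pow p :
  continuous (fun x : 'rV[R]_D => (dotp x (a p.1) ^+ 2) ^+ k.+1).
Proof.
have -> : (fun x : 'rV[R]_D => (dotp x (a p.1) ^+ 2) ^+ k.+1)
    = horner 'X^(2 * k.+1) \o (fun x => dotp x (a p.1)).
  by apply/funext => x /=; rewrite hornerXn exprM.
move=> x; exact: (continuous_comp (continuous_dotp_id (x := x)) (@continuous_horner _ _ _)).
Qed.

Lemma region_compact p : compact (region p).
Proof.
apply: bounded_closed_compact.
  exists 1; split; first exact: num_real.
  move=> M M1 x [x1 _ _]; rewrite /= [leLHS]/Num.Def.normr /= mx_normrE.
  apply: bigmax_le => [|[i j] _ /=]; first by lra.
  rewrite ord1; apply: le_trans (ltW M1); apply: ler_norm_sqr => //.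
  rewrite expr1n -x1 /dotp (bigD1 j) //= -expr2 lerDl.
  by apply: sumr_ge0 => l _; rewrite -expr2 sqr_ge0.
have -> : region p = ((fun x : 'rV[R]_D => dotp x x) @^-1` [set 1]) `&`
   (((fun x => dotp x (signed a p)) @^-1` [set y | 0 <= y]) `&`
    ((fun x => (dotp x (a p.1) ^+ 2) ^+ k.+1) @^-1` [set y | 4 / 5 <= y])).
  by apply/seteqP; split=> x /=; [case | case=> ? []].
apply: closedI; last apply: closedI.
- apply: preimage_closed; last exact: closed_eq.
  by move=> x _; apply: continuous_dotp => y; exact: cvg_id.
- apply: preimage_closed; last exact: closed_ge.
  by move=> x _; exact: continuous_dotp_id.
- apply: preimage_closed; last exact: closed_ge.
  by move=> x _; exact: continuous_dotp_pow.
Qed.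

Lemma signed_region p : region p (signed a p).
Proof.
have s1 := (sphereE _).1 (signed_sphere p).
split=> //; first by rewrite s1.
by rewrite -dotp_signed_sqr s1 !expr1n; lra.
Qed.

Lemma region_axis x p : region p x -> 4 / 5 <= dotp x (a p.1) ^+ 2.
Proof.
move=> [x1 _ h]; apply: (le_trans h); rewrite exprS; apply: ler_piMr.
  exact: sqr_ge0.
by apply: exprn_ile1; [exact: sqr_ge0 | apply: sqr_dotp_le1 => //; apply/sphereE].
Qed.

Section NoiseBelowThreshold.
Hypothesis hDelta : (2 + 3 * N ^+ 2) * Delta <= 2 * t * (1 - 2 * Delta).
Hypothesis hDelta_lt : 0 < 1 - 2 * Delta.

Lemma N_Delta_small p : N * Delta <= 1 / 21.
Proof.
have [_ _ _ _ t1] := rho_small ha tau_ge0 p.1.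
have N2 := N_ge2 R k; have D0 := Delta_ge0 a B.
have h1 : 7 * N * Delta <= (2 + 3 * N ^+ 2) * Delta.
  apply: ler_wpM2r => //; have : 0 <= (3 * N - 1) * (N - 2) by apply: mulr_ge0; lra.
  lra.
have h2 : 2 * t * (1 - 2 * Delta) <= 1 / 3 * (1 - 2 * Delta).
  by apply: ler_wpM2r; [exact: ltW | lra].
by have := hDelta; lra.
Qed.

Lemma Fobj_signed p : 1 - Delta <= Fobj B (signed a p).
Proof.
have := Fobj_lower B ha p.1 (signed_sphere p).
by rewrite -dotp_signed_sqr (sphereE _).1 ?expr1n; [lra | exact: signed_sphere].
Qed.

(** At such a value both inequalities defining the region are strict, hence persist nearby. Equality
    in the power is excluded by [Fobj_upper], which applies because inside the region [a p.1] has
    the largest correlation. *)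
Lemma region_interior p x : region p x -> 1 - Delta <= Fobj B x ->
  \forall y \near x, sphere y -> region p y.
Proof.
move=> rx Fx; have [x1 px Mx] := rx; have hx : sphere x by apply/sphereE.
have mu := region_axis rx.
have [r20 rn0 r21 rn1 t1] := rho_small ha tau_ge0 p.1.
have /andP[c11 c12] := c1_bounds ha tau_ge0 p.1.
have N2 := N_ge2 R k; have D0 := Delta_ge0 a B; have ND := N_Delta_small p.
have D42 : Delta <= 1 / 42 by have := ler_wpM2r D0 N2; lra.
have px' : 0 < dotp x (signed a p).
  by rewrite lt_def px andbT; apply: contraTneq mu => h0;
     rewrite -dotp_signed_sqr h0 expr0n -ltNge /=; lra.
have Mx' : 4 / 5 < (dotp x (a p.1) ^+ 2) ^+ k.+1.
  rewrite lt_def Mx andbT; apply: contraTneq Fx => M45; rewrite -ltNge.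
  have hmax j : `|dotp x (a j)| <= `|dotp x (a p.1)|.
    have [->//|ji] := eqVneq j p.1; apply: ler_norm_sqr => //.
    rewrite real_normK ?num_real //.
    by have := other_dotp_le ha hx ji; lra.
  have := Fobj_upper ha tau_ge0 hx hmax; rewrite M45.
  have : (1 + r2) * c1 <= 25 / 24 * (36 / 35) by apply: ler_pM; lra.
  by have := Fobj_close a B hx; rewrite ler_norml => /andP[h1 h2]; lra.
have o1 : \forall y \near x, 0 < dotp y (signed a p).
  exact: (cvgr_gt _ (continuous_dotp_id (x := x)) _ px').
have o2 : \forall y \near x, 4 / 5 < (dotp y (a p.1) ^+ 2) ^+ k.+1.
  exact: (cvgr_gt _ (continuous_dotp_pow (x := x)) _ Mx').
near=> y => /sphereE y1; split=> //; apply: ltW; near: y; [exact: o1 | exact: o2].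
Unshelve. all: by end_near. Qed.

(** Interiority turns a maximum over the region into a local maximum on the sphere, hence a critical
    point of high value. Localization puts it near some axis, and separation identifies that axis
    with [p]. *)
Lemma maximizer_critical p x : region p x ->
    (forall y, region p y -> Fobj B y <= Fobj B x) ->
  [/\ second_order_critical (Fobj B) x, 1 - Delta <= Fobj B x & near_axis x p].
Proof.
move=> rx hmax; have [x1 px Mx] := rx; have hx : sphere x by apply/sphereE.
have Fx := le_trans (Fobj_signed p) (hmax _ (signed_region p)).
have hc : second_order_critical (Fobj B) x.
  apply: local_max_critical => //.
  by apply: filterS (region_interior rx Fx) => y ry /ry; exact: hmax.
have hf : (2 + 3 * N ^+ 2) * Delta <= 2 * t * (Fobj B x - Delta).
  by apply: (le_trans hDelta); apply: ler_wpM2l; [rewrite mulr_ge0 | lra].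
have [|q [hq ND]] := critical_near_axis hc _ hf; first by have := hDelta_lt; lra.
split=> //; suff -> : p = q by [].
apply: (signed_separated hx px _ (region_axis rx)); first by case: hq.
exact: near_axis_sqr.
Qed.

Lemma maximizer_exists p : exists2 x, region p x &
  forall y, region p y -> Fobj B y <= Fobj B x.
Proof.
have [||x] := @EVT_max_rV R D (Fobj B) (region p) _ (region_compact (p := p)).
- by exists (signed a p); exact: signed_region.
- by apply: continuous_subspaceT; exact: continuous_Fobj.
rewrite inE => rx hmax; exists x => // y ry; apply: hmax; rewrite inE; exact: ry.
Qed.

(** Strictness comes from uniqueness: a nearby point of at least the same value would also maximize
    over the region, hence be critical in the same cap and equal to [x]. *)
Lemma axis_critical_point p : exists x,
  [/\ second_order_critical (Fobj B) x, 1 - Delta <= Fobj B x, near_axis x p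
    & strict_local_max (Fobj B) x].
Proof.
have [x rx hmax] := maximizer_exists p; exists x.
have [hc Fx nx] := maximizer_critical rx hmax; split=> //; split.
  by case: hc.
apply: filterS (region_interior rx Fx) => y ry hy; apply: contra_neqT.
rewrite -leNgt => Fxy.
have [|hcy _ ny] := @maximizer_critical p y (ry hy).
  by move=> w rw; apply: le_trans Fxy; exact: hmax.
exact: (near_axis_unique hcy hc ny nx (N_Delta_small p)).
Qed.

End NoiseBelowThreshold.

End Conclusion.

(** * Counting the high critical points under noise *)

Section Noise.
Variables (R : realType) (D K k : nat) (a : 'I_K -> 'rV[R]_D).
Variable B : {vspace tensor R D k.+2}.
Hypothesis ha : forall i, sphere (a i).
Hypothesis tau_ge0 : 0 <= tau k.+2 a.
Implicit Types (x y z : 'rV[R]_D) (i j : 'I_K).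

Local Notation N := (k.+2%:R : R).
Local Notation Delta := (DeltaA a B).
Local Notation t := (tau k.+2 a).

(** The squared distance is [2 * (1 - c)] with [c = dotp x (signed a p)] in [0, 1], so it is at most
    [2 * (1 - c ^+ 2)]; the claim follows with a factor 10 to spare. *)
Lemma near_axis_enorm x p : sphere x -> near_axis a B x p ->
  enorm (x - signed a p) ^+ 2 <= 2 * Delta / N.
Proof.
move=> hx [px dx]; rewrite enorm_signed //.
have N2 := N_ge2 R k; have N0 : 0 < N by lra.
have D0 := Delta_ge0 a B.
have := ler_wpM2l (ltW N0) (dotp_signed_ge ha hx px).
by rewrite ler_pdivlMr //; lra.
Qed.

(** For the uniqueness of the pair: any signed vector within the claimed distance meets the
    conditions of [signed_separated]. *)
Lemma near_axis_of_enorm x p : sphere x -> N * Delta <= 1 / 21 ->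
    enorm (x - signed a p) ^+ 2 <= 2 * Delta / N ->
  0 <= dotp x (signed a p) /\ 4 / 5 <= dotp x (a p.1) ^+ 2.
Proof.
move=> hx hD; rewrite enorm_signed // -dotp_signed_sqr.
have N2 := N_ge2 R k; have N0 : 0 < N by lra.
have D0 := Delta_ge0 a B.
have D42 := ler_wpM2r D0 N2.
have : 2 * Delta / N <= Delta.
  by rewrite ler_pdivrMr //; lra.
move=> h1 /le_trans - /(_ _ h1); set d := dotp x (signed a p) => h2.
have dge : 9 / 10 <= d by lra.
split; first by lra.
have : 9 / 10 * (9 / 10) <= d * d by apply: ler_pM; lra.
by rewrite -expr2; lra.
Qed.

Lemma high_critical_near_axis x : 0 < t -> high_critical a B x ->
  exists p, near_axis a B x p /\ N * Delta <= 1 / 21.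
Proof.
move=> t0 [hc hl F0]; have D0 := Delta_ge0 a B.
have N2 := N_ge2 R k; have N4 : 4 <= N ^+ 2 by nra.
have {}hl : (2 + 2 * t + 3 * N ^+ 2) * Delta <= 2 * t * Fobj B x.
  move: hl; rewrite /level mulrAC ler_pdivrMr; last by lra.
  by rewrite mulrC [Fobj B x * _]mulrC mulrC.
have hf : (2 + 3 * N ^+ 2) * Delta <= 2 * t * (Fobj B x - Delta) by lra.
(* A value at most [Delta] would make the right side of [hf] nonpositive, forcing [Delta = 0] and
   then a nonpositive value; this is where [0 < Fobj B x] enters. *)
apply: critical_near_axis => //; rewrite ltNge; apply/negP => f0.
have h1 : 2 * t * (Fobj B x - Delta) <= 0 by apply: mulr_ge0_le0; lra.
have h2 : 2 * Delta <= (2 + 3 * N ^+ 2) * Delta by apply: ler_wpM2r; lra.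
lra.
Qed.

Lemma high_critical_points : 0 < t -> Delta < Delta0 k.+2 a ->
  [/\ high_critical a B #= `I_(2 * K),
      forall x, high_critical a B x -> strict_local_max (Fobj B) x
    & forall x, high_critical a B x -> exists! p : 'I_K * bool,
        enorm (x - signed a p) ^+ 2 <= 2 * Delta / N].
Proof.
move=> t0; have D0 := Delta_ge0 a B; have N2 := N_ge2 R k.
have N4 : 4 <= N ^+ 2 by nra.
rewrite /Delta0 ltr_pdivlMr; last by lra.
move=> hD; have hDelta : (2 + 3 * N ^+ 2) * Delta <= 2 * t * (1 - 2 * Delta) by lra.
have hDelta1 : 0 < 1 - 2 * Delta.
  rewrite -(pmulr_rgt0 _ (_ : 0 < 2 * t)); last by lra.
  have : 0 <= (2 + 3 * N ^+ 2) * Delta by apply: mulr_ge0 => //; lra.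
  lra.
(* One critical point per signed vector. Uniqueness in a cap shows that these are all; separation
   shows that they are distinct. *)
have [xs hxs] := choice (axis_critical_point ha tau_ge0 hDelta hDelta1).
have hcE x p : high_critical a B x -> near_axis a B x p -> N * Delta <= 1 / 21 ->
    x = xs p.
  move=> [hc _ _] hp ND; have [hcp _ np _] := hxs p.
  exact: (near_axis_unique ha tau_ge0 hc hcp hp np ND).
have xs_high p : high_critical a B (xs p).
  have [hcp Fp _ _] := hxs p; split=> //; last by lra.
  apply: le_trans Fp; rewrite /level mulrAC ler_pdivrMr; last by lra.
  lra.
have Ehc : high_critical a B = range xs.
  apply/seteqP; split=> [x hx|_ [p _ <-] //].
  by have [p [np ND]] := high_critical_near_axis t0 hx; exists p => //;
     rewrite (hcE x p).
have ND (p : 'I_K * bool) := N_Delta_small ha tau_ge0 hDelta hDelta1 p.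
have xs_inj : injective xs.
  move=> p q Epq; have [[hx _ _] _ np _] := hxs p; have [_ _ nq _] := hxs q.
  rewrite -Epq in nq.
  exact: (signed_separated ha tau_ge0 hx (proj1 np) (proj1 nq)
    (near_axis_sqr np (ND p)) (near_axis_sqr nq (ND p))).
split.
- rewrite Ehc; have := card_range_fin xs_inj.
  by rewrite card_prod card_ord card_bool mulnC.
- by move=> x; rewrite Ehc => -[p _ <-]; have [] := hxs p.
- move=> x; rewrite Ehc => -[p _ <-]; have [[hx _ _] _ np _] := hxs p.
  exists p; split; first exact: near_axis_enorm.
  move=> q /(near_axis_of_enorm hx (ND p)) [q0 q1].
  exact: (signed_separated ha tau_ge0 hx (proj1 np) q0 (near_axis_sqr np (ND p)) q1).
Qed.

End Noise.

(** * The noiseless case *)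

Section Noiseless.
Variables (R : realType) (D K k : nat) (a : 'I_K -> 'rV[R]_D).
Hypothesis ha : forall i, sphere (a i).
Hypothesis tau_ge0 : 0 <= tau k.+2 a.
Local Notation A := (spanA k.+2 a).

Lemma DeltaA_spanA : DeltaA a A = 0.
Proof.
rewrite /DeltaA /opnorm.
have -> : [set frob_norm (oproj A T - oproj A T) | T in
    [set T : tensor R D k.+2 | frob_norm T <= 1]] = [set 0].
  apply/seteqP; split=> [_ [T _ <-]|_ ->] /=.
    by rewrite subrr /frob_norm frob0l sqrtr0.
  by exists 0; rewrite ?subrr /= /frob_norm frob0l sqrtr0.
exact: sup1.
Qed.

Lemma signed_global_max p : Fobj A (signed a p) = 1 /\
  global_max (Fobj A) (signed a p).
Proof.
have hp := signed_sphere ha p.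
have F1 : Fobj A (signed a p) = 1.
  apply/eqP; rewrite eq_le Fobj_le1 //=.
  have := Fobj_lower A ha p.1 hp.
  by rewrite DeltaA_spanA -dotp_signed_sqr (sphereE _).1 // expr1n; lra.
by split=> //; split=> // y hy; rewrite F1; exact: Fobj_le1.
Qed.

Lemma global_max_critical x : global_max (Fobj A) x -> second_order_critical (Fobj A) x.
Proof.
move=> [hx hmax]; apply: local_max_critical => //.
by apply: (@filterS _ _ (nbhs_filter x) setT) filterT => y _; exact: hmax.
Qed.

(** With zero noise the level condition holds at every point of positive value, and the distance
    bound collapses to 0. *)
Lemma positive_critical_signed :
  [set x | second_order_critical (Fobj A) x /\ 0 < Fobj A x] = range (signed a).
Proof.
apply/seteqP; split=> [x [hc F0]|_ [p _ <-]] /=; last first.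
  have [F1 hg] := signed_global_max p.
  by split; [exact: global_max_critical | rewrite F1].
have := critical_near_axis ha tau_ge0 hc; rewrite DeltaA_spanA subr0 => /(_ F0).
rewrite mulr0 => /(_ _)[|p [np _]]; first by apply: mulr_ge0; [apply: mulr_ge0 | exact: ltW].
exists p => //; apply/esym/eqP; rewrite -subr_eq0; apply/eqP/dotp_eq0.
have hx : sphere x by case: hc.
have := near_axis_enorm ha hx np; rewrite DeltaA_spanA mulr0 mul0r enorm_sqr => h.
by apply/eqP; rewrite eq_le h dotp_ge0.
Qed.

Lemma signed_inj : injective (signed a).
Proof.
move=> p q Epq; have hp := signed_sphere ha p; have hq := signed_sphere ha q.
apply: (signed_separated ha tau_ge0 hp); rewrite -?dotp_signed_sqr ?Epq;
  by rewrite (sphereE _).1 // ?expr1n; lra.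
Qed.

End Noiseless.

Theorem theorem7 (R : realType) (D n K : nat) (hn : (2 <= n)%N)
    (a : 'I_K -> 'rV[R]_D) (ha : forall i : 'I_K, sphere (a i))
    (Ahat : {vspace tensor R D n})
    (hAhat : forall T : tensor R D n, T \in Ahat -> symmetric_tensor T) :
  (0 < tau n a -> DeltaA a Ahat < Delta0 n a ->
    [/\ high_critical a Ahat #= `I_(2 * K),
        forall x : 'rV[R]_D, high_critical a Ahat x ->
          strict_local_max (Fobj Ahat) x
      & forall x : 'rV[R]_D, high_critical a Ahat x ->
          exists! p : 'I_K * bool,
            enorm (x - signed a p) ^+ 2 <= 2 * DeltaA a Ahat / n%:R])
  /\
  (0 <= tau n a ->
    let crit := [set x | second_order_critical (Fobj (spanA n a)) x /\
                         0 < Fobj (spanA n a) x] in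
    [/\ crit #= `I_(2 * K),
        crit = range (signed a)
      & (0 < K)%N -> [set x | global_max (Fobj (spanA n a)) x] = range (signed a)]).
Proof.
case: n hn Ahat hAhat => [|[|k]] // _ Ahat _; split=> [t0 hD|t0 crit].
  exact: (high_critical_points ha (ltW t0) t0 hD).
rewrite /crit (positive_critical_signed ha t0); split=> //.
  have := card_range_fin (signed_inj ha t0).
  by rewrite card_prod card_ord card_bool mulnC.
move=> K0; apply/seteqP; split=> [x hg|_ [p _ <-]] /=; last first.
  by case: (signed_global_max k ha p).
suff : range (signed a) x by [].
rewrite -(positive_critical_signed ha t0); split; first exact: global_max_critical.
(* As [K] is positive, some signed vector has value 1, so a global maximizer has positive value. *)
have [F1 _] := signed_global_max k ha (Ordinal K0, false).
by case: hg => _ /(_ _ (signed_sphere ha (Ordinal K0, false))); rewrite F1; lra.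
Qed.
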